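(* Let $\gamma \geq 0$ be an integer. The operads $\mathsf{Dias}_\gamma$, $\mathsf{Dendr}_\gamma$, $\mathsf{As}_\gamma$, and $\mathsf{DAs}_\gamma$ fit into the diagram $$\mathsf{Dendr}_\gamma \xleftarrow{\ \zeta_\gamma\ } \mathsf{DAs}_\gamma \overset{!}{\longleftrightarrow} \mathsf{As}_\gamma \xleftarrow{\ \eta_\gamma\ } \mathsf{Dias}_\gamma, \qquad \mathsf{Dendr}_\gamma \overset{!}{\longleftrightarrow} \mathsf{Dias}_\gamma,$$ where $\overset{!}{\longleftrightarrow}$ indicates Koszul dual operads, and where: the map $\eta_\gamma$ satisfying $\eta_\gamma(0a) = \mathfrak{c}_a = \eta_\gamma(a0)$ for all $a \in [\gamma]$, with $\mathfrak{c}_a$ the arity-$2$ $\gamma$-corolla labeled by $a$ (that is, the generator $\star_a$ of $\mathsf{As}_\gamma$), extends in a unique way into an operad morphism $\eta_\gamma : \mathsf{Dias}_\gamma \to \mathsf{As}_\gamma$, and this morphism is surjective; the map $\zeta_\gamma$ sending, for all $a \in [\gamma]$, the $\gamma$-alternating Schröder tree with two leaves and one internal node labeled by $a$ (that is, the generator $\diamond_a$ of $\mathsf{DAs}_\gamma$) to the sum of the two $\gamma$-edge valued binary trees with two internal nodes whose internal edge is labeled by $a$ (that is, to the image of $\prec_a + \succ_a$ in $\mathsf{Dendr}_\gamma$) extends in a unique way into an operad morphism $\zeta_\gamma : \mathsf{DAs}_\gamma \to \mathsf{Dendr}_\gamma$.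
   Context: The ground field has characteristic zero; operad means nonsymmetric operad; $[n] = \{1, \dots, n\}$; $a \uparrow a' := \max(a, a')$. $\mathbf{Free}(\mathfrak{G})$ is the free operad on a set $\mathfrak{G}$ of binary generators; $(\mathfrak{G}, \mathfrak{R})$ is a presentation of $\mathcal{O}$ if $\mathcal{O} \cong \mathbf{Free}(\mathfrak{G})/\langle \mathfrak{R} \rangle$. Koszul dual: if $\mathcal{O}$ has a presentation $(\mathfrak{G}, \mathfrak{R})$ with $\mathfrak{G}$ in arity $2$ and $\mathfrak{R} \subseteq \mathbf{Free}(\mathfrak{G})(3)$, its Koszul dual is $\mathbf{Free}(\mathfrak{G})/\langle \mathfrak{R}^\perp \rangle$, where $\mathfrak{R}^\perp$ is the annihilator of $\mathfrak{R}$ in $\mathbf{Free}(\mathfrak{G})(3)$ for the bilinear form with $\langle x \circ_i y, x' \circ_{i'} y' \rangle = 1$ if $x = x', y = y', i = i' = 1$; $= -1$ if $x = x', y = y', i = i' = 2$; and $0$ otherwise ($x, x', y, y' \in \mathfrak{G}$). $\mathsf{Dias}_\gamma$: the operad whose arity-$n$ component is spanned by the words of length $n$ on $\{0\} \cup [\gamma]$ with exactly one $0$, with $u \circ_i v := u_1 \dots u_{i-1} \max(u_i, v_1) \dots \max(u_i, v_m) u_{i+1} \dots u_n$. It is presented by generators $\dashv_a, \vdash_a$, $a \in [\gamma]$ (standing for the words $0a$ and $a0$) and the space of relations spanned, for all $a, a' \in [\gamma]$, by $\dashv_a \circ_1 \vdash_{a'} - \vdash_{a'} \circ_2 \dashv_a$;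 $\dashv_a \circ_1 \dashv_{a \uparrow a'} - \dashv_a \circ_2 \vdash_{a'}$; $\vdash_a \circ_1 \dashv_{a'} - \vdash_a \circ_2 \vdash_{a \uparrow a'}$; $\dashv_{a \uparrow a'} \circ_1 \dashv_a - \dashv_a \circ_2 \dashv_{a'}$; $\vdash_a \circ_1 \vdash_{a'} - \vdash_{a \uparrow a'} \circ_2 \vdash_a$. $\mathsf{Dendr}_\gamma$: the Koszul dual of $\mathsf{Dias}_\gamma$ computed from this presentation, with dual generators $\leftharpoonup_a, \rightharpoonup_a$ corresponding to $\dashv_a, \vdash_a$; one sets $\prec_b := \sum_{a \in [b]} \leftharpoonup_a$ and $\succ_b := \sum_{a \in [b]} \rightharpoonup_a$. Its arity-$n$ component is realized by the $\gamma$-edge valued binary trees with $n$ internal nodes (planar binary trees with edges between internal nodes labeled by $[\gamma]$); in arity $2$, $\prec_a$ (resp. $\succ_a$) corresponds to the tree with two internal nodes in which the non-root internal node is the right (resp. left) child of the root, the internal edge being labeled by $a$. $\mathsf{As}_\gamma$: the operad with binary generators $\star_a$, $a \in [\gamma]$, and relations generated by $\star_a \circ_1 \star_{a'} - \star_{a \uparrow a'} \circ_2 \star_{a \uparrow a'}$ and $\star_a \circ_2 \star_{a'} - \star_{a \uparrow a'} \circ_2 \star_{a \uparrow a'}$, $a, a' \in [\gamma]$. It is realized by $\gamma$-corollas: the leaf (unit) and, in each arity $n \geq 2$, the corollas with $n$ leaves labeled by $a \in [\gamma]$, a partial composition of corollas labeled by $a$ and $a'$ being labeled by $a \uparrow a'$;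 $\star_a$ corresponds to the arity-$2$ corolla labeled by $a$. $\mathsf{DAs}_\gamma$: the Koszul dual of $\mathsf{As}_\gamma$ computed from this presentation, with dual generators $\lozenge_a$ corresponding to $\star_a$; one sets $\diamond_b := \sum_{a \in [b]} \lozenge_a$. Over the generators $\diamond_a$, its space of relations is generated by $\diamond_a \circ_1 \diamond_a - \diamond_a \circ_2 \diamond_a$, $a \in [\gamma]$. It is realized by $\gamma$-alternating Schröder trees (planar rooted trees with internal nodes having at least two children and labeled by $[\gamma]$, adjacent internal nodes having different labels; the partial composition is grafting followed by contraction of the new edge if its two extremities have a same label), $\diamond_a$ corresponding to the tree with two leaves and one internal node labeled by $a$. *)

(* Defs.v *)
From HB Require Import structures.
From mathcomp Require Import all_boot all_order all_algebra.
From mathcomp Require Import generic_quotient ring_quotient zify.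
From mathcomp.classical Require Import boolp.

Set Implicit Arguments.
Unset Strict Implicit.
Unset Printing Implicit Defensive.

Import Order.TTheory GRing.Theory.
Local Open Scope ring_scope.

(******************************************************************************)
(* Nonsymmetric operads.  Arities are positive, so components are indexed     *)
(* from 0: [O n] is the component of arity n.+1.  Inputs are numbered from 0, *)
(* and composing arities n.+1 and m.+1 gives arity (n + m).+1; the index p of *)
(* the result comes with a proof of n + m = p, so that the associativity laws *)
(* need no transport.                                                         *)
(******************************************************************************)

Record operad (K : fieldType) := Operad {
  op_car :> nat -> lmodType K;
  op_one : op_car 0;
  op_comp : forall n m p : nat, (n + m = p)%N -> 'I_n.+1 ->
    op_car n -> op_car m -> op_car p;
  op_linl : forall n m p (e : (n + m = p)%N) (i : 'I_n.+1) (y : op_car m),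
    linear (fun x : op_car n => op_comp e i x y);
  op_linr : forall n m p (e : (n + m = p)%N) (i : 'I_n.+1) (x : op_car n),
    linear (fun y : op_car m => op_comp e i x y);
  op_unitl : forall n (e : (0 + n = n)%N) (i : 'I_1) (x : op_car n),
    op_comp e i op_one x = x;
  op_unitr : forall n (e : (n + 0 = n)%N) (i : 'I_n.+1) (x : op_car n),
    op_comp e i x op_one = x;
  op_seqA : forall n m l nm ml p (e1 : (n + m = nm)%N) (e2 : (nm + l = p)%N)
      (e3 : (m + l = ml)%N) (e4 : (n + ml = p)%N)
      (i : 'I_n.+1) (j : 'I_m.+1) (k : 'I_nm.+1)
      (x : op_car n) (y : op_car m) (z : op_car l),
    k = (i + j)%N :> nat ->
    op_comp e2 k (op_comp e1 i x y) z = op_comp e4 i x (op_comp e3 j y z);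
  op_parA : forall n m l nm nl p (e1 : (n + m = nm)%N) (e2 : (nm + l = p)%N)
      (e3 : (n + l = nl)%N) (e4 : (nl + m = p)%N)
      (i k : 'I_n.+1) (k' : 'I_nm.+1) (i' : 'I_nl.+1)
      (x : op_car n) (y : op_car m) (z : op_car l),
    (i < k)%N -> k' = (k + m)%N :> nat -> i' = i :> nat ->
    op_comp e2 k' (op_comp e1 i x y) z = op_comp e4 i' (op_comp e3 k x z) y
}.

Definition is_operad_morphism (K : fieldType) (O P : operad K)
    (phi : forall n, O n -> P n) : Prop :=
  [/\ forall n, linear (phi n),
      phi 0%N (op_one O) = op_one P
    & forall n m p (e : (n + m = p)%N) (i : 'I_n.+1) (x : O n) (y : O m),
        phi p (op_comp e i x y) = op_comp e i (phi n x) (phi m y)].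

Definition operad_iso (K : fieldType) (O P : operad K) : Prop :=
  exists2 phi : forall n, O n -> P n,
    is_operad_morphism phi & forall n, bijective (phi n).

Record set_operad := SetOperad {
  so_car :> nat -> finType;
  so_one : so_car 0;
  so_comp : forall n m p : nat, (n + m = p)%N -> 'I_n.+1 ->
    so_car n -> so_car m -> so_car p;
  so_unitl : forall n (e : (0 + n = n)%N) (i : 'I_1) (x : so_car n),
    so_comp e i so_one x = x;
  so_unitr : forall n (e : (n + 0 = n)%N) (i : 'I_n.+1) (x : so_car n),
    so_comp e i x so_one = x;
  so_seqA : forall n m l nm ml p (e1 : (n + m = nm)%N) (e2 : (nm + l = p)%N)
      (e3 : (m + l = ml)%N) (e4 : (n + ml = p)%N)
      (i : 'I_n.+1) (j : 'I_m.+1) (k : 'I_nm.+1)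
      (x : so_car n) (y : so_car m) (z : so_car l),
    k = (i + j)%N :> nat ->
    so_comp e2 k (so_comp e1 i x y) z = so_comp e4 i x (so_comp e3 j y z);
  so_parA : forall n m l nm nl p (e1 : (n + m = nm)%N) (e2 : (nm + l = p)%N)
      (e3 : (n + l = nl)%N) (e4 : (nl + m = p)%N)
      (i k : 'I_n.+1) (k' : 'I_nm.+1) (i' : 'I_nl.+1)
      (x : so_car n) (y : so_car m) (z : so_car l),
    (i < k)%N -> k' = (k + m)%N :> nat -> i' = i :> nat ->
    so_comp e2 k' (so_comp e1 i x y) z = so_comp e4 i' (so_comp e3 k x z) y
}.

Section Linearization.
Variables (K : fieldType) (A : set_operad).

Definition delta (T : finType) (t : T) : {ffun T -> K^o} :=
  [ffun u => (u == t)%:R].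

Lemma delta_sum (T : finType) (f : {ffun T -> K^o}) :
  f = \sum_t f t *: delta t.
Proof.
apply/ffunP => u; rewrite sum_ffunE (bigD1 u) //= big1 ?addr0.
  by rewrite !ffunE eqxx [_ *: _]mulr1.
by move=> v /negPf vu; rewrite !ffunE eq_sym vu [_ *: _]mulr0.
Qed.

Definition lin_comp n m p (e : (n + m = p)%N) (i : 'I_n.+1)
    (f : {ffun A n -> K^o}) (g : {ffun A m -> K^o}) : {ffun A p -> K^o} :=
  \sum_u \sum_v (f u * g v) *: delta (so_comp e i u v).

Lemma lin_comp_linl n m p (e : (n + m = p)%N) i g :
  linear (fun f => @lin_comp n m p e i f g).
Proof.
move=> a f f'; rewrite /lin_comp scaler_sumr -big_split /=.
apply: eq_bigr => u _; rewrite scaler_sumr -big_split /=.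
apply: eq_bigr => v _; rewrite !ffunE scalerA -scalerDl; congr (_ *: _).
by rewrite mulrDl mulrA.
Qed.

Lemma lin_comp_linr n m p (e : (n + m = p)%N) i f :
  linear (fun g => @lin_comp n m p e i f g).
Proof.
move=> a g g'; rewrite /lin_comp scaler_sumr -big_split /=.
apply: eq_bigr => u _; rewrite scaler_sumr -big_split /=.
apply: eq_bigr => v _; rewrite !ffunE scalerA -scalerDl; congr (_ *: _).
by rewrite mulrDr mulrCA.
Qed.

Lemma lin_comp_delta n m p (e : (n + m = p)%N) i u v :
  @lin_comp n m p e i (delta u) (delta v) = delta (so_comp e i u v).
Proof.
rewrite /lin_comp (bigD1 u) //= [X in _ + X]big1 => [|u' /negPf uu']; last first.
  by rewrite big1 // => v' _; rewrite !ffunE uu' mul0r scale0r.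
rewrite addr0 (bigD1 v) //= big1 => [|v' /negPf vv'].
  by rewrite !ffunE !eqxx mulr1 scale1r addr0.
by rewrite !ffunE vv' mulr0 scale0r.
Qed.

Lemma linear_sum_comb (U V : lmodType K) (f : U -> V) (T : finType)
    (c : T -> K) (F : T -> U) :
  linear f -> f (\sum_t c t *: F t) = \sum_t c t *: f (F t).
Proof.
move=> lf; have f0 : f 0 = 0.
  by have := lf (-1) 0 0; rewrite scaler0 addr0 scaleN1r addNr.
apply: (big_ind2 (fun u v => f u = v)) => [//|x y x' y' <- <-|t _].
  by have := lf 1 x x'; rewrite !scale1r.
by have := lf (c t) (F t) 0; rewrite f0 !addr0.
Qed.

Lemma lin_comp_suml n m p (e : (n + m = p)%N) i (T : finType) (c : T -> K) F g :
  @lin_comp n m p e i (\sum_t c t *: F t) g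
  = \sum_t c t *: lin_comp e i (F t) g.
Proof. exact: linear_sum_comb (lin_comp_linl e i g). Qed.

Lemma lin_comp_sumr n m p (e : (n + m = p)%N) i (T : finType) (c : T -> K) f F :
  @lin_comp n m p e i f (\sum_t c t *: F t)
  = \sum_t c t *: lin_comp e i f (F t).
Proof. exact: linear_sum_comb (lin_comp_linr e i f). Qed.

Lemma lin_unitl n (e : (0 + n = n)%N) (i : 'I_1) f :
  lin_comp e i (delta (so_one A)) f = f.
Proof.
rewrite [in LHS](delta_sum f) lin_comp_sumr [RHS]delta_sum.
by apply: eq_bigr => u _; rewrite lin_comp_delta so_unitl.
Qed.

Lemma lin_unitr n (e : (n + 0 = n)%N) (i : 'I_n.+1) f :
  lin_comp e i f (delta (so_one A)) = f.
Proof.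
rewrite [in LHS](delta_sum f) lin_comp_suml [RHS]delta_sum.
by apply: eq_bigr => u _; rewrite lin_comp_delta so_unitr.
Qed.

Lemma lin_seqA n m l nm ml p (e1 : (n + m = nm)%N) (e2 : (nm + l = p)%N)
    (e3 : (m + l = ml)%N) (e4 : (n + ml = p)%N)
    (i : 'I_n.+1) (j : 'I_m.+1) (k : 'I_nm.+1) f g h :
  k = (i + j)%N :> nat ->
  lin_comp e2 k (lin_comp e1 i f g) h = lin_comp e4 i f (lin_comp e3 j g h).
Proof.
move=> kE; rewrite (delta_sum f) !lin_comp_suml; apply: eq_bigr => u _.
congr (_ *: _); rewrite (delta_sum g) lin_comp_sumr !lin_comp_suml lin_comp_sumr.
apply: eq_bigr => v _; congr (_ *: _); rewrite (delta_sum h) !lin_comp_sumr.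
apply: eq_bigr => w _; congr (_ *: _); rewrite !lin_comp_delta.
by rewrite (so_seqA _ _ e3 e4 _ _ _ kE).
Qed.

Lemma lin_parA n m l nm nl p (e1 : (n + m = nm)%N) (e2 : (nm + l = p)%N)
    (e3 : (n + l = nl)%N) (e4 : (nl + m = p)%N)
    (i k : 'I_n.+1) (k' : 'I_nm.+1) (i' : 'I_nl.+1) f g h :
  (i < k)%N -> k' = (k + m)%N :> nat -> i' = i :> nat ->
  lin_comp e2 k' (lin_comp e1 i f g) h = lin_comp e4 i' (lin_comp e3 k f h) g.
Proof.
move=> ik k'E i'E; rewrite (delta_sum f) !lin_comp_suml; apply: eq_bigr => u _.
congr (_ *: _); rewrite (delta_sum g) !lin_comp_sumr !lin_comp_suml.
apply: eq_bigr => v _; congr (_ *: _).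
rewrite (delta_sum h) !lin_comp_sumr lin_comp_suml.
apply: eq_bigr => w _; congr (_ *: _); rewrite !lin_comp_delta.
by rewrite (so_parA _ _ e3 e4 _ _ _ ik k'E i'E).
Qed.

Definition linearize : operad K :=
  @Operad K (fun n => {ffun A n -> K^o} : lmodType K) (delta (so_one A))
    lin_comp lin_comp_linl lin_comp_linr lin_unitl lin_unitr lin_seqA lin_parA.

End Linearization.

Arguments delta K {T} t.

Section QuotientModule.
Variables (K : fieldType) (V : lmodType K) (S : submodClosed V).

Definition submod_pred : {pred V} := S.

Lemma submod_pred_opp : oppr_closed submod_pred.
Proof. by move=> x Sx; rewrite -scaleN1r; apply: rpredZ. Qed.

HB.instance Definition _ := GRing.SubmodClosed.on submod_pred.
HB.instance Definition _ := GRing.isOppClosed.Build V submod_pred submod_pred_opp.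

Definition quot_mod := Quotient.quot submod_pred.
HB.instance Definition _ := Choice.on quot_mod.
HB.instance Definition _ := GRing.Zmodule.on quot_mod.

Definition quot_pi (x : V) : quot_mod := (\pi_(Quotient.quot submod_pred) x)%qT.
Definition quot_repr (x : quot_mod) : V := generic_quotient.repr x.

Lemma quot_reprK x : quot_pi (quot_repr x) = x.
Proof. exact: reprK. Qed.

Lemma quot_piP x y : reflect (quot_pi x = quot_pi y) (x - y \in S).
Proof.
have -> : (x - y \in S) = (x - y \in submod_pred) by [].
by rewrite Quotient.idealrBE; apply: eqP.
Qed.

Lemma quot_piD x y : quot_pi (x + y) = quot_pi x + quot_pi y.
Proof. exact: (@raddfD _ _ (\pi_(Quotient.quot submod_pred))%qT). Qed.

Definition quot_scale (a : K) (x : quot_mod) : quot_mod :=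
  quot_pi (a *: quot_repr x).

Lemma quot_piZ a x : quot_pi (a *: x) = quot_scale a (quot_pi x).
Proof.
apply/quot_piP; rewrite -scalerBr rpredZ //.
by apply/quot_piP; rewrite quot_reprK.
Qed.

Lemma quot_scaleA a b x : quot_scale a (quot_scale b x) = quot_scale (a * b) x.
Proof. by rewrite -(quot_reprK x) -!quot_piZ scalerA. Qed.

Lemma quot_scale1 : left_id 1 quot_scale.
Proof. by move=> x; rewrite -(quot_reprK x) -!quot_piZ scale1r. Qed.

Lemma quot_scaleDr : right_distributive quot_scale +%R.
Proof.
move=> a x y; rewrite -(quot_reprK x) -(quot_reprK y).
by rewrite -!quot_piZ -!quot_piD -quot_piZ scalerDr.
Qed.

Lemma quot_scaleDl x : {morph quot_scale^~ x : a b / a + b}.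
Proof. by move=> a b; rewrite -(quot_reprK x) -!quot_piZ scalerDl quot_piD. Qed.

HB.instance Definition _ := GRing.Zmodule_isLmodule.Build K quot_mod
  quot_scaleA quot_scale1 quot_scaleDr quot_scaleDl.

Lemma quot_pi_linear : linear quot_pi.
Proof. by move=> a x y; rewrite quot_piD quot_piZ. Qed.

End QuotientModule.

Record operad_ideal (K : fieldType) (O : operad K) := OperadIdeal {
  id_car :> forall n, submodClosed (O n);
  id_compl : forall n m p (e : (n + m = p)%N) (i : 'I_n.+1) (x : O n) (y : O m),
    x \in id_car n -> op_comp e i x y \in id_car p;
  id_compr : forall n m p (e : (n + m = p)%N) (i : 'I_n.+1) (x : O n) (y : O m),
    y \in id_car m -> op_comp e i x y \in id_car p
}.

Section QuotientOperad.
Variables (K : fieldType) (O : operad K) (I : operad_ideal O).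

Definition qop_comp n m p (e : (n + m = p)%N) (i : 'I_n.+1)
    (x : quot_mod (I n)) (y : quot_mod (I m)) : quot_mod (I p) :=
  quot_pi (I p) (op_comp e i (quot_repr x) (quot_repr y)).

Lemma op_compBl n m p (e : (n + m = p)%N) (i : 'I_n.+1) (x x' : O n) (y : O m) :
  op_comp e i (x - x') y = op_comp e i x y - op_comp e i x' y.
Proof.
by rewrite addrC [RHS]addrC; have /= := op_linl e i y (-1) x' x; rewrite !scaleN1r.
Qed.

Lemma op_compBr n m p (e : (n + m = p)%N) (i : 'I_n.+1) (x : O n) (y y' : O m) :
  op_comp e i x (y - y') = op_comp e i x y - op_comp e i x y'.
Proof.
by rewrite addrC [RHS]addrC; have /= := op_linr e i x (-1) y' y; rewrite !scaleN1r.
Qed.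

Lemma qop_compE n m p (e : (n + m = p)%N) (i : 'I_n.+1) (x : O n) (y : O m) :
  qop_comp e i (quot_pi (I n) x) (quot_pi (I m) y)
  = quot_pi (I p) (op_comp e i x y).
Proof.
have rx : quot_repr (quot_pi (I n) x) - x \in I n.
  by apply/quot_piP; rewrite quot_reprK.
have ry : quot_repr (quot_pi (I m) y) - y \in I m.
  by apply/quot_piP; rewrite quot_reprK.
rewrite /qop_comp; set x' := quot_repr _ in rx *; set y' := quot_repr _ in ry *.
apply/quot_piP.
have -> : op_comp e i x' y' - op_comp e i x y
        = op_comp e i (x' - x) y' + op_comp e i x (y' - y).
  by rewrite op_compBl op_compBr addrA subrK.
by apply: rpredD; [exact: id_compl | exact: id_compr].
Qed.

Lemma qop_linl n m p (e : (n + m = p)%N) (i : 'I_n.+1) (y : quot_mod (I m)) :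
  linear (fun x : quot_mod (I n) => qop_comp e i x y).
Proof.
move=> a x x'; rewrite -(quot_reprK x) -(quot_reprK x') -(quot_reprK y).
by rewrite -quot_pi_linear !qop_compE op_linl quot_pi_linear.
Qed.

Lemma qop_linr n m p (e : (n + m = p)%N) (i : 'I_n.+1) (x : quot_mod (I n)) :
  linear (fun y : quot_mod (I m) => qop_comp e i x y).
Proof.
move=> a y y'; rewrite -(quot_reprK x) -(quot_reprK y) -(quot_reprK y').
by rewrite -quot_pi_linear !qop_compE op_linr quot_pi_linear.
Qed.

Lemma qop_unitl n (e : (0 + n = n)%N) (i : 'I_1) (x : quot_mod (I n)) :
  qop_comp e i (quot_pi (I 0%N) (op_one O)) x = x.
Proof. by rewrite -(quot_reprK x) qop_compE op_unitl. Qed.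

Lemma qop_unitr n (e : (n + 0 = n)%N) (i : 'I_n.+1) (x : quot_mod (I n)) :
  qop_comp e i x (quot_pi (I 0%N) (op_one O)) = x.
Proof. by rewrite -(quot_reprK x) qop_compE op_unitr. Qed.

Lemma qop_seqA n m l nm ml p (e1 : (n + m = nm)%N) (e2 : (nm + l = p)%N)
    (e3 : (m + l = ml)%N) (e4 : (n + ml = p)%N)
    (i : 'I_n.+1) (j : 'I_m.+1) (k : 'I_nm.+1)
    (x : quot_mod (I n)) (y : quot_mod (I m)) (z : quot_mod (I l)) :
  k = (i + j)%N :> nat ->
  qop_comp e2 k (qop_comp e1 i x y) z = qop_comp e4 i x (qop_comp e3 j y z).
Proof.
move=> kE; rewrite -(quot_reprK x) -(quot_reprK y) -(quot_reprK z) !qop_compE.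
by rewrite (op_seqA _ _ e3 e4 _ _ _ kE).
Qed.

Lemma qop_parA n m l nm nl p (e1 : (n + m = nm)%N) (e2 : (nm + l = p)%N)
    (e3 : (n + l = nl)%N) (e4 : (nl + m = p)%N)
    (i k : 'I_n.+1) (k' : 'I_nm.+1) (i' : 'I_nl.+1)
    (x : quot_mod (I n)) (y : quot_mod (I m)) (z : quot_mod (I l)) :
  (i < k)%N -> k' = (k + m)%N :> nat -> i' = i :> nat ->
  qop_comp e2 k' (qop_comp e1 i x y) z = qop_comp e4 i' (qop_comp e3 k x z) y.
Proof.
move=> ik k'E i'E.
rewrite -(quot_reprK x) -(quot_reprK y) -(quot_reprK z) !qop_compE.
by rewrite (op_parA _ _ e3 e4 _ _ _ ik k'E i'E).
Qed.

Definition quot_operad : operad K :=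
  @Operad K (fun n => quot_mod (I n) : lmodType K) (quot_pi (I 0%N) (op_one O))
    qop_comp qop_linl qop_linr qop_unitl qop_unitr qop_seqA qop_parA.

End QuotientOperad.

Section GeneratedIdeal.
Variables (K : fieldType) (O : operad K) (k : nat) (R : O k -> Prop).

Definition gen_pred n : {pred O n} := fun x =>
  `[< forall J : operad_ideal O, (forall r, R r -> r \in J k) -> x \in J n >].

Lemma gen_pred_submod n : submod_closed (@gen_pred n).
Proof.
split; first by apply/asboolP => J _; rewrite rpred0.
move=> a x y /asboolP Ix /asboolP Iy; apply/asboolP => J RJ.
by rewrite rpredD ?rpredZ ?Ix ?Iy.
Qed.

HB.instance Definition _ n :=
  GRing.isSubmodClosed.Build K (O n) (@gen_pred n) (gen_pred_submod n).

Lemma gen_compl n m p (e : (n + m = p)%N) (i : 'I_n.+1) (x : O n) (y : O m) :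
  x \in @gen_pred n -> op_comp e i x y \in @gen_pred p.
Proof.
by move=> /asboolP Ix; apply/asboolP => J RJ; apply: id_compl; apply: Ix.
Qed.

Lemma gen_compr n m p (e : (n + m = p)%N) (i : 'I_n.+1) (x : O n) (y : O m) :
  y \in @gen_pred m -> op_comp e i x y \in @gen_pred p.
Proof.
by move=> /asboolP Iy; apply/asboolP => J RJ; apply: id_compr; apply: Iy.
Qed.

Definition ideal_gen : operad_ideal O :=
  @OperadIdeal K O (fun n => @gen_pred n : submodClosed (O n))
    gen_compl gen_compr.

End GeneratedIdeal.

(******************************************************************************)
(* The free operad on binary generators: its arity n.+1 component is spanned  *)
(* by the planar binary trees with n internal nodes labeled by generators.    *)
(******************************************************************************)

Inductive tree (G : Type) := Leaf | Node of G & tree G & tree G.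
Arguments Leaf {G}.

Section Trees.
Variable G : finType.

Fixpoint nodes (t : tree G) : nat :=
  if t is Node _ l r then (nodes l + nodes r).+1 else 0%N.

Fixpoint tree_code (t : tree G) : seq (option G) :=
  if t is Node g l r then Some g :: tree_code l ++ tree_code r else [:: None].

Definition tree_decode (s : seq (option G)) : option (tree G) :=
  ohead (foldr (fun c st => match c, st with
                  | None, _ => Leaf :: st
                  | Some g, l :: r :: st' => Node g l r :: st'
                  | Some _, _ => st
                  end) [::] s).

Lemma tree_codeK : pcancel tree_code tree_decode.
Proof.
move=> t; rewrite /tree_decode -[tree_code t]cats0.
set f := fun _ _ => _.
have fE s : foldr f [::] (tree_code t ++ s) = t :: foldr f [::] s.
  elim: t s => [//|g l IHl r IHr] s /=.
  by rewrite -catA IHl IHr.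
by rewrite fE.
Qed.

HB.instance Definition _ := Countable.copy (tree G) (pcan_type tree_codeK).

Lemma size_tree_code t : size (tree_code t) == (nodes t).*2.+1.
Proof.
by elim: t => //= g l /eqP IHl r /eqP IHr; rewrite size_cat IHl IHr; lia.
Qed.

Definition ntree n := {t : tree G | nodes t == n}.

HB.instance Definition _ n := Countable.on (ntree n).

Lemma ntree_code_subproof n (t : ntree n) :
  size (tree_code (val t)) == n.*2.+1.
Proof. by rewrite (eqP (size_tree_code _)) (eqP (valP t)). Qed.

Definition ntree_code n (t : ntree n) : n.*2.+1.-tuple (option G) :=
  Tuple (ntree_code_subproof t).

Definition ntree_decode n (s : n.*2.+1.-tuple (option G)) : option (ntree n) :=
  obind insub (tree_decode s).

Lemma ntree_codeK n : pcancel (@ntree_code n) (@ntree_decode n).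
Proof. by move=> t; rewrite /ntree_decode tree_codeK /= valK. Qed.

HB.instance Definition _ n : isFinite (ntree n) :=
  PCanIsFinite (@ntree_codeK n).

(* Replaces by s the i-th leaf of t, for i <= nodes t. *)
Fixpoint graft (t : tree G) (i : nat) (s : tree G) : tree G :=
  match t with
  | Leaf => s
  | Node g l r =>
      if (i <= nodes l)%N then Node g (graft l i s) r
      else Node g l (graft r (i - (nodes l).+1) s)
  end.

Lemma nodes_graft t i s : nodes (graft t i s) = (nodes t + nodes s)%N.
Proof.
elim: t i => [//|g l IHl r IHr] i /=.
by case: ifP => _ /=; rewrite ?IHl ?IHr; lia.
Qed.

Lemma graft_leaf t i : (i <= nodes t)%N -> graft t i Leaf = t.
Proof.
elim: t i => [//|g l IHl r IHr] i /= it.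
by case: ifP => il; rewrite ?IHl ?IHr //; lia.
Qed.

Lemma graft_seqA t i s j u : (i <= nodes t)%N -> (j <= nodes s)%N ->
  graft (graft t i s) (i + j) u = graft t i (graft s j u).
Proof.
elim: t i => [|g l IHl r IHr] i /= it js.
  by have -> : i = 0%N by lia.
case: ifP => il /=.
  by rewrite nodes_graft ifT ?IHl //; lia.
rewrite ifF; last by lia.
by rewrite -IHr //; [congr (Node _ _ (graft _ _ _)) | ]; lia.
Qed.

Lemma graft_parA t i k s u : (i < k)%N -> (k <= nodes t)%N ->
  graft (graft t i s) (k + nodes s) u = graft (graft t k u) i s.
Proof.
elim: t i k => [|g l IHl r IHr] i k /= ik kt; first by lia.
have [il|il] := leqP i (nodes l); have [kl|kl] := leqP k (nodes l) => /=.
- by rewrite !nodes_graft !ifT ?IHl //; lia.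
- rewrite nodes_graft il ifF; last by lia.
  by congr (Node _ _ (graft _ _ _)); lia.
- by lia.
rewrite !ifF; try by lia.
by rewrite -IHr; [congr (Node _ _ (graft _ _ _)) | | ]; lia.
Qed.

Definition ntree_leaf : ntree 0 := Sub Leaf (eqxx 0%N).

Lemma ntree_comp_subproof n m p (e : (n + m = p)%N) (i : nat)
    (x : ntree n) (y : ntree m) : nodes (graft (val x) i (val y)) == p.
Proof. by rewrite nodes_graft (eqP (valP x)) (eqP (valP y)) e. Qed.

Definition ntree_comp n m p (e : (n + m = p)%N) (i : 'I_n.+1)
    (x : ntree n) (y : ntree m) : ntree p :=
  Sub (graft (val x) i (val y)) (ntree_comp_subproof e i x y).

Lemma ord_le_nodes n (x : ntree n) (i : 'I_n.+1) : (i <= nodes (val x))%N.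
Proof. by rewrite (eqP (valP x)) -ltnS. Qed.

Lemma ntree_unitl n (e : (0 + n = n)%N) (i : 'I_1) (x : ntree n) :
  ntree_comp e i ntree_leaf x = x.
Proof. exact: val_inj. Qed.

Lemma ntree_unitr n (e : (n + 0 = n)%N) (i : 'I_n.+1) (x : ntree n) :
  ntree_comp e i x ntree_leaf = x.
Proof. by apply: val_inj; rewrite /= graft_leaf ?ord_le_nodes. Qed.

Lemma ntree_seqA n m l nm ml p (e1 : (n + m = nm)%N) (e2 : (nm + l = p)%N)
    (e3 : (m + l = ml)%N) (e4 : (n + ml = p)%N)
    (i : 'I_n.+1) (j : 'I_m.+1) (k : 'I_nm.+1)
    (x : ntree n) (y : ntree m) (z : ntree l) :
  k = (i + j)%N :> nat ->
  ntree_comp e2 k (ntree_comp e1 i x y) z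
  = ntree_comp e4 i x (ntree_comp e3 j y z).
Proof.
by move=> kE; apply: val_inj; rewrite /= kE graft_seqA ?ord_le_nodes.
Qed.

Lemma ntree_parA n m l nm nl p (e1 : (n + m = nm)%N) (e2 : (nm + l = p)%N)
    (e3 : (n + l = nl)%N) (e4 : (nl + m = p)%N)
    (i k : 'I_n.+1) (k' : 'I_nm.+1) (i' : 'I_nl.+1)
    (x : ntree n) (y : ntree m) (z : ntree l) :
  (i < k)%N -> k' = (k + m)%N :> nat -> i' = i :> nat ->
  ntree_comp e2 k' (ntree_comp e1 i x y) z
  = ntree_comp e4 i' (ntree_comp e3 k x z) y.
Proof.
move=> ik k'E i'E; apply: val_inj => /=.
by rewrite k'E i'E -[in (k + m)%N](eqP (valP y)) graft_parA ?ord_le_nodes.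
Qed.

Definition tree_operad : set_operad :=
  @SetOperad (fun n => ntree n : finType) ntree_leaf ntree_comp
    ntree_unitl ntree_unitr ntree_seqA ntree_parA.

Definition corolla (g : G) : tree_operad 1%N :=
  Sub (Node g Leaf Leaf) (eqxx 1%N).

End Trees.

Definition Free (K : fieldType) (G : finType) : operad K :=
  linearize K (tree_operad G).

Section Presentations.
Variables (K : fieldType) (G : finType).

Definition gen (g : G) : Free K G 1%N := delta K (corolla g).

Definition comp1 (O : operad K) (x y : O 1%N) : O 2%N :=
  @op_comp K O 1%N 1%N 2%N (erefl 2%N) (ord0 : 'I_2) x y.
Definition comp2 (O : operad K) (x y : O 1%N) : O 2%N :=
  @op_comp K O 1%N 1%N 2%N (erefl 2%N) (ord_max : 'I_2) x y.

Definition Pres (R : Free K G 2%N -> Prop) : operad K :=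
  quot_operad (ideal_gen R).

Definition pgen (R : Free K G 2%N -> Prop) (g : G) : Pres R 1%N :=
  quot_pi (ideal_gen R 1%N) (gen g).

Definition presentation (R : Free K G 2%N -> Prop) (O : operad K) : Prop :=
  operad_iso O (Pres R).

(* The elements x o_1 y and x o_2 y, for generators x and y, form the tree    *)
(* basis of arity 3; quad_form is the bilinear form for which this basis is   *)
(* orthogonal, with <x o_1 y, x o_1 y> = 1 and <x o_2 y, x o_2 y> = -1.       *)
Definition tree1 (x y : G) : tree_operad G 2%N :=
  @so_comp (tree_operad G) 1%N 1%N 2%N (erefl 2%N) (ord0 : 'I_2) (corolla x) (corolla y).
Definition tree2 (x y : G) : tree_operad G 2%N :=
  @so_comp (tree_operad G) 1%N 1%N 2%N (erefl 2%N) (ord_max : 'I_2) (corolla x) (corolla y).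

Definition quad_form (f g : Free K G 2%N) : K :=
  \sum_(x : G) \sum_(y : G)
    ((f : {ffun _ -> K^o}) (tree1 x y) * (g : {ffun _ -> K^o}) (tree1 x y)
     - (f : {ffun _ -> K^o}) (tree2 x y) * (g : {ffun _ -> K^o}) (tree2 x y)).

Definition orth (R : Free K G 2%N -> Prop) (f : Free K G 2%N) : Prop :=
  forall r, R r -> quad_form f r = 0.

(* O' is the Koszul dual of O computed from the presentation of O by R; R may *)
(* be any spanning set of the space of relations, since both the ideal and    *)
(* the annihilator only depend on its span.                                   *)
Definition koszul_dual (R : Free K G 2%N -> Prop) (O O' : operad K) : Prop :=
  presentation R O /\ operad_iso O' (Pres (orth R)).

End Presentations.

(* Letters are 'I_gamma.+1, standing for {0} u [gamma]. *)

Definition up k (a b : 'I_k) : 'I_k := Order.max a b.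

Lemma upA k : associative (@up k).
Proof. by move=> a b c; rewrite /up maxA. Qed.

Lemma upC k : commutative (@up k).
Proof. by move=> a b; rewrite /up maxC. Qed.

Section DiasWords.
Variable gamma : nat.

Local Notation letter := 'I_gamma.+1.

Definition one_zero (w : seq letter) : bool := count_mem ord0 w == 1%N.

Definition word n := {w : n.+1.-tuple letter | one_zero w}.

Definition word_subst (u : seq letter) (i : nat) (v : seq letter) :
    seq letter :=
  take i u ++ [seq up (nth ord0 u i) b | b <- v] ++ drop i.+1 u.

Lemma size_word_subst u i v : (i < size u)%N ->
  size (word_subst u i v) = (size u + size v).-1.
Proof.
by move=> iu; rewrite !size_cat size_map size_drop size_takel; lia.
Qed.

Lemma up0letter (b : letter) : up ord0 b = b.
Proof. by apply/max_idPr; rewrite leEord. Qed.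

Lemma upletter_eq0 (a b : letter) :
  (up a b == ord0) = (a == ord0) && (b == ord0).
Proof.
apply/idP/idP => [/eqP E|/andP[/eqP-> /eqP->]]; last by rewrite up0letter.
have: (a <= up a b)%O by rewrite /up le_max lexx.
have: (b <= up a b)%O by rewrite /up le_max lexx orbT.
rewrite E !leEord /= !leqn0 => /eqP b0 /eqP a0.
by apply/andP; split; apply/eqP/val_inj.
Qed.

Lemma one_zero_subst u i v : (i < size u)%N -> one_zero u -> one_zero v ->
  one_zero (word_subst u i v).
Proof.
move=> iu; rewrite /one_zero /word_subst => /eqP u1 /eqP v1.
rewrite !count_cat count_map.
move: u1; rewrite -{1}(cat_take_drop i u) count_cat (drop_nth ord0 iu) /=.
set a := nth ord0 u i.
have -> : count (preim (up a) (pred1 ord0)) v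
        = ((a == ord0) * count_mem ord0 v)%N.
  case: (eqVneq a ord0) => [->|a0].
    by rewrite mul1n; apply: eq_count => b /=; rewrite up0letter.
  rewrite mul0n; apply/eqP; rewrite -leqn0 leqNgt -has_count.
  by apply/hasPn => b _ /=; rewrite upletter_eq0 (negPf a0).
by rewrite v1 muln1 => ->.
Qed.

Lemma word_comp_size n m p (e : (n + m = p)%N) (i : 'I_n.+1)
    (u : word n) (v : word m) : size (word_subst (val u) i (val v)) == p.+1.
Proof. by rewrite size_word_subst !size_tuple //; apply/eqP; lia. Qed.

Lemma word_comp_one_zero n m p (e : (n + m = p)%N) (i : 'I_n.+1)
    (u : word n) (v : word m) : one_zero (Tuple (word_comp_size e i u v)).
Proof.
by apply: one_zero_subst; [rewrite size_tuple | exact: (valP u) | exact: (valP v)].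
Qed.

Definition word_comp n m p (e : (n + m = p)%N) (i : 'I_n.+1)
    (u : word n) (v : word m) : word p :=
  Sub (Tuple (word_comp_size e i u v)) (word_comp_one_zero e i u v).

Definition word_one : word 0 := Sub [tuple ord0] (eqxx 1%N).

Lemma word_unitl n (e : (0 + n = n)%N) (i : 'I_1) (x : word n) :
  word_comp e i word_one x = x.
Proof.
do 2!apply: val_inj; rewrite /= /word_subst (ord1 i) /= cats0.
by rewrite -[RHS]map_id; apply: eq_map => b; rewrite up0letter.
Qed.

Lemma word_unitr n (e : (n + 0 = n)%N) (i : 'I_n.+1) (x : word n) :
  word_comp e i x word_one = x.
Proof.
do 2!apply: val_inj; rewrite /= /word_subst /= upC up0letter.
by rewrite -drop_nth ?size_tuple // cat_take_drop.
Qed.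

Lemma nth_word_subst u i v k : (i < size u)%N ->
  nth ord0 (word_subst u i v) k =
    if (k < i)%N then nth ord0 u k
    else if (k < i + size v)%N then
      up (nth ord0 u i) (nth ord0 v (k - i))
    else nth ord0 u (k - size v).+1.
Proof.
move=> iu; rewrite /word_subst !nth_cat size_map size_takel; last by lia.
case: ifP => ki; first by rewrite nth_take.
have -> : (k - i < size v)%N = (k < i + size v)%N by lia.
case: ifP => kv; first by rewrite (nth_map ord0) //; lia.
by rewrite nth_drop; congr nth; lia.
Qed.

Lemma word_seqA n m l nm ml p (e1 : (n + m = nm)%N) (e2 : (nm + l = p)%N)
    (e3 : (m + l = ml)%N) (e4 : (n + ml = p)%N)
    (i : 'I_n.+1) (j : 'I_m.+1) (k : 'I_nm.+1)
    (x : word n) (y : word m) (z : word l) :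
  k = (i + j)%N :> nat ->
  word_comp e2 k (word_comp e1 i x y) z
  = word_comp e4 i x (word_comp e3 j y z).
Proof.
move=> kE; do 2!apply: val_inj; apply: (@eq_from_nth _ ord0) => [|q _] /=.
  by rewrite !size_word_subst ?size_tuple ?ltn_ord //;
    have := ltn_ord i; have := ltn_ord k; lia.
have sx := size_tuple (val x); have sy := size_tuple (val y).
have sz := size_tuple (val z).
have li := ltn_ord i; have lj := ltn_ord j.
have sxy : size (word_subst (val x) i (val y)) = (n + m).+1.
  by rewrite size_word_subst sx ?sy //; lia.
have syz : size (word_subst (val y) j (val z)) = (m + l).+1.
  by rewrite size_word_subst sy ?sz //; lia.
rewrite [LHS]nth_word_subst ?sxy; last by lia.
rewrite [RHS]nth_word_subst ?sx // !nth_word_subst ?sx ?sy //.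
rewrite ?syz ?sz kE.
have -> : (i + j < i)%N = false by lia.
have -> : (i + j < i + m.+1)%N by lia.
have -> : (i + j - i = j)%N by lia.
case: (ltnP q i) => qi; first by rewrite ifT //; lia.
case: (ltnP q (i + j)) => qij.
  rewrite !ifT; try by lia.
  by [].
case: (ltnP q (i + j + l.+1)) => qijl.
  rewrite ifT; last by lia.
  rewrite ifF; last by lia.
  rewrite ifT; last by lia.
  by rewrite upA; congr (up _ (nth _ _ _)); lia.
rewrite ifF; last by lia.
case: (ltnP q (i + (m + l).+1)) => qq.
  rewrite ifT; last by lia.
  rewrite ifF; last by lia.
  rewrite ifF; last by lia.
  by congr (up _ (nth _ _ _)); lia.
rewrite ifF; last by lia.
by congr nth; lia.
Qed.

Lemma word_parA n m l nm nl p (e1 : (n + m = nm)%N) (e2 : (nm + l = p)%N)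
    (e3 : (n + l = nl)%N) (e4 : (nl + m = p)%N)
    (i k : 'I_n.+1) (k' : 'I_nm.+1) (i' : 'I_nl.+1)
    (x : word n) (y : word m) (z : word l) :
  (i < k)%N -> k' = (k + m)%N :> nat -> i' = i :> nat ->
  word_comp e2 k' (word_comp e1 i x y) z
  = word_comp e4 i' (word_comp e3 k x z) y.
Proof.
move=> ik k'E i'E; do 2!apply: val_inj.
apply: (@eq_from_nth _ ord0) => [|q _] /=.
  by rewrite !size_word_subst ?size_tuple ?ltn_ord //;
    have := ltn_ord i; have := ltn_ord k; lia.
have sx := size_tuple (val x); have sy := size_tuple (val y).
have sz := size_tuple (val z).
have li := ltn_ord i; have lk := ltn_ord k.
have sxy : size (word_subst (val x) i (val y)) = (n + m).+1.
  by rewrite size_word_subst sx ?sy //; lia.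
have sxz : size (word_subst (val x) k (val z)) = (n + l).+1.
  by rewrite size_word_subst sx ?sz //; lia.
rewrite [LHS]nth_word_subst ?sxy; last by lia.
rewrite [RHS]nth_word_subst ?sxz; last by lia.
rewrite !nth_word_subst ?sx // ?sy ?sz k'E i'E.
have -> : (k + m < i)%N = false by lia.
have -> : (k + m < i + m.+1)%N = false by lia.
have -> : ((k + m - m.+1).+1 = k)%N by lia.
rewrite ik.
case: (ltnP q i) => qi; first by rewrite !ifT //; lia.
case: (ltnP q (i + m.+1)) => qim.
  by rewrite ifT //; lia.
case: (ltnP q (k + m)) => qkm.
  by rewrite ifT //; lia.
case: (ltnP q (k + m + l.+1)) => qkml.
  rewrite ifF; last by lia.
  rewrite ifT; last by lia.
  by congr (up _ (nth _ _ _)); lia.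
rewrite !ifF; try by lia.
by congr nth; lia.
Qed.

Definition word_operad : set_operad :=
  @SetOperad (fun n => word n : finType) word_one word_comp
    word_unitl word_unitr word_seqA word_parA.

Lemma word0a_subproof (a : 'I_gamma) :
  one_zero [tuple ord0; lift ord0 a].
Proof. by []. Qed.

Lemma worda0_subproof (a : 'I_gamma) :
  one_zero [tuple lift ord0 a; ord0].
Proof. by []. Qed.

Definition word0a (a : 'I_gamma) : word_operad 1%N :=
  Sub [tuple ord0; lift ord0 a] (word0a_subproof a).

Definition worda0 (a : 'I_gamma) : word_operad 1%N :=
  Sub [tuple lift ord0 a; ord0] (worda0_subproof a).

End DiasWords.

Section FourOperads.
Variables (K : fieldType) (gamma : nat).

(* An index a : 'I_gamma stands for a.+1 in [gamma]. *)

Definition Dias : operad K := linearize K (word_operad gamma).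

Definition dias_gens : finType := ('I_gamma + 'I_gamma)%type.

Definition dashv (a : 'I_gamma) : Free K dias_gens 1%N := gen K (inl a).
Definition vdash (a : 'I_gamma) : Free K dias_gens 1%N := gen K (inr a).

Inductive dias_rel : Free K dias_gens 2%N -> Prop :=
| DiasRel1 a a' :
    dias_rel (comp1 (dashv a) (vdash a') - comp2 (vdash a') (dashv a))
| DiasRel2 a a' :
    dias_rel (comp1 (dashv a) (dashv (up a a')) - comp2 (dashv a) (vdash a'))
| DiasRel3 a a' :
    dias_rel (comp1 (vdash a) (dashv a') - comp2 (vdash a) (vdash (up a a')))
| DiasRel4 a a' :
    dias_rel (comp1 (dashv (up a a')) (dashv a) - comp2 (dashv a) (dashv a'))
| DiasRel5 a a' :
    dias_rel (comp1 (vdash a) (vdash a') - comp2 (vdash (up a a')) (vdash a)).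

Definition Dendr : operad K := Pres (orth dias_rel).

Definition dendr_prec (b : 'I_gamma) : Dendr 1%N :=
  \sum_(a : 'I_gamma | (a <= b)%N) pgen (orth dias_rel) (inl a).
Definition dendr_succ (b : 'I_gamma) : Dendr 1%N :=
  \sum_(a : 'I_gamma | (a <= b)%N) pgen (orth dias_rel) (inr a).

Definition as_gen (a : 'I_gamma) : Free K 'I_gamma 1%N := gen K a.

Inductive as_rel : Free K 'I_gamma 2%N -> Prop :=
| AsRel1 a a' : as_rel (comp1 (as_gen a) (as_gen a')
                        - comp2 (as_gen (up a a')) (as_gen (up a a')))
| AsRel2 a a' : as_rel (comp2 (as_gen a) (as_gen a')
                        - comp2 (as_gen (up a a')) (as_gen (up a a'))).

Definition As : operad K := Pres as_rel.

Definition as_star (a : 'I_gamma) : As 1%N := pgen as_rel a.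

Definition DAs : operad K := Pres (orth as_rel).

Definition das_diamond (b : 'I_gamma) : DAs 1%N :=
  \sum_(a : 'I_gamma | (a <= b)%N) pgen (orth as_rel) a.

End FourOperads.

Arguments dias_rel : clear implicits.
Arguments as_rel : clear implicits.

(* Main.v *)
From HB Require Import structures.
Require Import Defs.
From mathcomp Require Import all_boot all_order all_algebra zify.
From mathcomp.classical Require Import boolp.

(******************************************************************************)
(* Dias is presented by its relations because every tree on the generators is *)
(* congruent to                                                               *)
(*   . |-_{u_1} (... (. |-_{u_k} ((. -|_{v_1} .) ... -|_{v_l} .))),           *)
(* where the word u 0 v is the value of the tree in Dias: two trees with the  *)
(* same value are thus congruent.  By nondegeneracy of the quadratic form, a  *)
(* double annihilator generates the same ideal as the relations, so Koszul    *)
(* duality is symmetric.  The morphism eta identifies -|_a and |-_a with      *)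
(* star_a; its transpose for the quadratic forms sends lozenge_a to the sum   *)
(* of the two dual generators, hence maps annihilator to annihilator, and it  *)
(* induces zeta.  The diamonds determine the lozenges by triangularity.       *)
(******************************************************************************)

Set Implicit Arguments.
Unset Strict Implicit.
Unset Printing Implicit Defensive.

Import Order.TTheory GRing.Theory.
Local Open Scope ring_scope.

(** * Morphisms out of free operads *)

(** Both morphisms come from universal properties: [free_ext] extends any images of the generators
    to the free operad, the extension descends to a presentation once it kills the relations
    ([pres_ext_exists]), and a morphism is determined on generators ([pres_morphism_eq]).

    In each relation of Dias the two trees have the same largest label, and in As the class of a
    tree with two nodes depends only on its largest label: this gives eta. An element annihilating
    the relations of As has, up to a sign given by the shape of the tree, coefficients depending
    only on the largest label. Pulled back along the map forgetting the side of a generator, it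
    annihilates the relations of Dias ([twin_orth]): this gives zeta.

    The substantial point is that Dias, defined by words, has no relations beyond the given ones.
    The relations bring every tree to a normal form that can be read off its word ([tree_cong_nf]),
    so the map from the presented operad is injective ([dias_presentation]). The symmetry of the
    duality is linear algebra in the finite-dimensional component of arity 3 ([orth_orth]). *)

Section LinearMaps.
Variables (K : fieldType) (U V : lmodType K) (f : U -> V).
Hypothesis lf : linear f.

Lemma linear_fun0 : f 0 = 0.
Proof. by have := lf (-1) 0 0; rewrite scaler0 addr0 scaleN1r addNr. Qed.

Lemma linear_funD x y : f (x + y) = f x + f y.
Proof. by have := lf 1 x y; rewrite !scale1r. Qed.

Lemma linear_funB x y : f (x - y) = f x - f y.
Proof. by have := lf (-1) y x; rewrite !scaleN1r ![- _ + _]addrC. Qed.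

Lemma linear_fun_sum (T : finType) (P : pred T) (F : T -> U) :
  f (\sum_(t | P t) F t) = \sum_(t | P t) f (F t).
Proof. exact: (big_morph f linear_funD linear_fun0). Qed.

End LinearMaps.

Section Morphisms.
Variable K : fieldType.
Implicit Types O P Q : operad K.

Lemma id_morphism O : is_operad_morphism (fun n (x : O n) => x).
Proof. by split. Qed.

Lemma comp_morphism O P Q (phi : forall n, O n -> P n) (psi : forall n, P n -> Q n) :
  is_operad_morphism phi -> is_operad_morphism psi ->
  is_operad_morphism (fun n x => psi n (phi n x)).
Proof.
move=> [phil phi1 phic] [psil psi1 psic]; split=> [n a x y||n m p e i x y].
- by rewrite phil psil.
- by rewrite phi1 psi1.
by rewrite phic psic.
Qed.

Lemma operad_iso_refl O : operad_iso O O.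
Proof.
exists (fun n (x : O n) => x); first exact: id_morphism.
by move=> n; exists id.
Qed.

Lemma operad_iso_trans O P Q : operad_iso O P -> operad_iso P Q -> operad_iso O Q.
Proof.
move=> [phi phiM phiB] [psi psiM psiB].
exists (fun n x => psi n (phi n x)); first exact: comp_morphism.
by move=> n; apply: bij_comp.
Qed.

End Morphisms.

Section TreeInduction.
Variable G : finType.

(** Building a node by two operadic compositions lets the operad axioms and the morphism laws apply
    to it directly; the free indices [q] and [p] avoid transport. *)
Definition node n m q p (e1 : (1 + n = q)%N) (e2 : (q + m = p)%N) (g : G)
    (l : ntree G n) (r : ntree G m) : ntree G p :=
  ntree_comp e2 ord_max (ntree_comp e1 ord0 (corolla g) l) r.

Lemma val_node n m q p (e1 : (1 + n = q)%N) (e2 : (q + m = p)%N) g l r :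
  val (@node n m q p e1 e2 g l r) = Node g (val l) (val r).
Proof.
by rewrite /= -e1 (eqP (valP l)) add1n ltnn.
Qed.

Lemma ntree_ind (Q : forall n, ntree G n -> Prop) :
  Q 0%N (ntree_leaf G) ->
  (forall n m q p (e1 : (1 + n = q)%N) (e2 : (q + m = p)%N) g l r,
     Q n l -> Q m r -> Q p (node e1 e2 g l r)) ->
  forall n t, Q n t.
Proof.
move=> Ql Qn n [t e]; elim: t n e => [|g l IHl r IHr] n e.
  have n0 : n = 0%N by rewrite -(eqP e).
  subst n; rewrite (_ : exist _ _ _ = ntree_leaf G) //; exact: val_inj.
have e1 : (1 + nodes l = (nodes l).+1)%N by [].
have e2 : ((nodes l).+1 + nodes r = n)%N by rewrite -(eqP e).
set l' : ntree G (nodes l) := exist _ l (eqxx _).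
set r' : ntree G (nodes r) := exist _ r (eqxx _).
have -> : exist _ (Node g l r) e = node e1 e2 g l' r'.
  by apply: val_inj; rewrite val_node.
by apply: Qn; [apply: IHl | apply: IHr].
Qed.

End TreeInduction.

Section FreeExtension.
Variables (K : fieldType) (G : finType) (P : operad K) (c : G -> P 1%N).

Fixpoint tree_ev (t : tree G) : P (nodes t) :=
  match t with
  | Leaf => op_one P
  | Node g l r =>
      op_comp (erefl ((nodes l).+1 + nodes r)%N) ord_max
        (op_comp (erefl (1 + nodes l)%N) ord0 (c g) (tree_ev l)) (tree_ev r)
  end.

(** The transport along [nodes t = n] is confined to this definition: the lemmas on leaves and nodes
    below determine the evaluation without casts. *)
Definition ntree_ev n (t : ntree G n) : P n :=
  ecast k (P k) (eqP (valP t)) (tree_ev (val t)).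

Lemma ntree_evE n (u : ntree G n) (t : tree G) (e : nodes t = n) :
  val u = t -> ntree_ev u = ecast k (P k) e (tree_ev t).
Proof. by move=> ut; subst t; rewrite /ntree_ev (eq_irrelevance (eqP _) e). Qed.

Lemma ntree_ev_leaf : ntree_ev (ntree_leaf G) = op_one P.
Proof. exact: (@ntree_evE _ _ Leaf erefl). Qed.

Lemma ntree_ev_node n m q p (e1 : (1 + n = q)%N) (e2 : (q + m = p)%N) g
    (l : ntree G n) (r : ntree G m) :
  ntree_ev (node e1 e2 g l r)
  = op_comp e2 ord_max (op_comp e1 ord0 (c g) (ntree_ev l)) (ntree_ev r).
Proof.
case: l r => l el [r er].
have el' := eqP el; have er' := eqP er; subst n m q p.
rewrite (@ntree_evE _ _ (Node g l r) erefl) ?val_node //=.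
by rewrite (@ntree_evE _ _ l erefl) // (@ntree_evE _ _ r erefl).
Qed.

(** Induction on the host tree. The operad axioms push the grafting of [s] into the subtree that
    contains leaf [i], by the same moves among trees and in [P]. *)
Lemma ntree_ev_comp n m p (e : (n + m = p)%N) (i : 'I_n.+1)
    (t : ntree G n) (s : ntree G m) :
  ntree_ev (ntree_comp e i t s) = op_comp e i (ntree_ev t) (ntree_ev s).
Proof.
move: n t p e i; apply: ntree_ind => [p e i|a b q n e1 e2 g l r IHl IHr p e i].
  by move: (e); subst p => e; rewrite ntree_unitl ntree_ev_leaf op_unitl.
have iE := ltn_ord i; rewrite ntree_ev_node /node.
have [ia|ia] := leqP i a.
  have e3 : (q + m = q + m)%N by [].
  have e4 : ((q + m) + b = p)%N by lia.
  have e5 : (a + m = a + m)%N by [].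
  have e6 : (1 + (a + m) = q + m)%N by lia.
  have iq : (i < q.+1)%N by lia.
  have ia1 : (i < a.+1)%N by lia.
  (* Leaf [i] lies in [l]: the parallel axiom, read backwards, grafts [s] before [r], and the
     sequential axiom then moves [s] inside [l]. *)
  rewrite -(@ntree_parA _ _ _ _ _ _ _ e3 e4 e2 e (Ordinal iq) ord_max ord_max) //=;
    try lia.
  rewrite (@ntree_seqA _ _ _ _ _ _ _ e1 e3 e5 e6 ord0 (Ordinal ia1)) //.
  rewrite -/(node e6 e4 g _ r) ntree_ev_node IHl.
  rewrite -(@op_parA _ P _ _ _ _ _ _ e3 e4 e2 e (Ordinal iq) ord_max ord_max) //=;
    try lia.
  by rewrite (@op_seqA _ P _ _ _ _ _ _ e1 e3 e5 e6 ord0 (Ordinal ia1)).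
have e3 : (b + m = b + m)%N by [].
have e4 : (q + (b + m) = p)%N by lia.
(* The [a.+1] leaves of [l] come first, so leaf [i] of the node is leaf [i - a.+1] of [r]. *)
have jb : (i - a.+1 < b.+1)%N by lia.
rewrite (@ntree_seqA _ _ _ _ _ _ _ e2 e e3 e4 ord_max (Ordinal jb)) //=; last by lia.
rewrite -/(node e1 e4 g l _) ntree_ev_node IHr.
by rewrite (@op_seqA _ P _ _ _ _ _ _ e2 e e3 e4 ord_max (Ordinal jb)) //=; lia.
Qed.

Lemma ntree_ev_corolla g : ntree_ev (corolla g) = c g.
Proof.
rewrite (@ntree_evE _ _ (Node g Leaf Leaf) erefl) //= op_unitr.
exact: op_unitr.
Qed.

Definition free_ext n (f : Free K G n) : P n :=
  \sum_t (f : {ffun _ -> K^o}) t *: ntree_ev t.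

Lemma free_ext_linear n : linear (@free_ext n).
Proof.
move=> a f f'; rewrite /free_ext scaler_sumr -big_split /=.
by apply: eq_bigr => t _; rewrite !ffunE scalerDl scalerA.
Qed.

Lemma free_ext_delta n (t : ntree G n) : free_ext (delta K t) = ntree_ev t.
Proof.
rewrite /free_ext (bigD1 t) //= big1 => [|u /negPf ut].
  by rewrite ffunE eqxx scale1r addr0.
by rewrite ffunE ut scale0r.
Qed.

Lemma free_ext_morphism : is_operad_morphism free_ext.
Proof.
split=> [n||n m p e i f g].
- exact: free_ext_linear.
- by rewrite [op_one _]/(delta K (ntree_leaf G)) free_ext_delta ntree_ev_leaf.
rewrite (delta_sum f) (linear_sum_comb _ _ (op_linl e i g)).
rewrite !(linear_sum_comb _ _ (@free_ext_linear _)).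
rewrite (linear_sum_comb _ _ (op_linl e i _)); apply: eq_bigr => t _; congr (_ *: _).
rewrite (delta_sum g) (linear_sum_comb _ _ (op_linr e i _)).
rewrite !(linear_sum_comb _ _ (@free_ext_linear _)).
rewrite (linear_sum_comb _ _ (op_linr e i _)); apply: eq_bigr => s _; congr (_ *: _).
by rewrite /= lin_comp_delta !free_ext_delta ntree_ev_comp.
Qed.

Lemma free_ext_gen g : free_ext (gen K g) = c g.
Proof. by rewrite free_ext_delta ntree_ev_corolla. Qed.

End FreeExtension.

(** * Presented operads *)

(** By linearity it suffices to compare on trees, and every tree is an iterated composition of
    corollas and the unit. *)
Lemma free_ext_unique (K : fieldType) (G : finType) (P : operad K)
    (phi : forall n, Free K G n -> P n) :
  is_operad_morphism phi ->
  forall n x, phi n x = free_ext (fun g => phi 1%N (gen K g)) x.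
Proof.
case=> phil phi1 phic n x.
rewrite (delta_sum x) (linear_sum_comb _ _ (phil n)).
rewrite (linear_sum_comb _ _ (@free_ext_linear _ _ _ _ n)).
apply: eq_bigr => t _; congr (_ *: _); rewrite free_ext_delta {x}.
move: n t; apply: ntree_ind => [|n m q p e1 e2 g l r IHl IHr].
  by rewrite ntree_ev_leaf -phi1.
rewrite ntree_ev_node -IHl -IHr -!phic; congr phi.
by rewrite /= !lin_comp_delta.
Qed.

Lemma free_morphism_eq (K : fieldType) (G : finType) (P : operad K)
    (phi psi : forall n, Free K G n -> P n) :
  is_operad_morphism phi -> is_operad_morphism psi ->
  (forall g, phi 1%N (gen K g) = psi 1%N (gen K g)) ->
  forall n x, phi n x = psi n x.
Proof.
move=> phiM psiM E n x; rewrite (free_ext_unique phiM) (free_ext_unique psiM).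
by rewrite (funext E).
Qed.

Section QuotientMorphisms.
Variables (K : fieldType) (O : operad K).

Lemma quot_pi_morphism (I : operad_ideal O) :
  is_operad_morphism (P := quot_operad I) (fun n => quot_pi (I n)).
Proof.
split=> [n||n m p e i x y] //; first exact: quot_pi_linear.
by rewrite /= qop_compE.
Qed.

Lemma quot_pi0 (I : operad_ideal O) n x : quot_pi (I n) x = 0 <-> x \in I n.
Proof.
rewrite -(linear_fun0 (@quot_pi_linear _ _ (I n))); split.
  by move/quot_piP; rewrite subr0.
by move=> Ix; apply/quot_piP; rewrite subr0.
Qed.

Variables (P : operad K) (phi : forall n, O n -> P n).
Arguments phi : clear implicits.
Hypothesis phiM : is_operad_morphism phi.

Definition morph_ker n : {pred O n} := fun x => phi n x == 0.

Lemma morph_ker_submod n : submod_closed (@morph_ker n).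
Proof.
have [phil _ _] := phiM.
split; first by apply/eqP; apply: linear_fun0.
by move=> a x y /eqP x0 /eqP y0; apply/eqP; rewrite phil x0 y0 scaler0 addr0.
Qed.

HB.instance Definition _ n :=
  GRing.isSubmodClosed.Build K (O n) (@morph_ker n) (morph_ker_submod n).

Lemma morph_ker_compl n m p (e : (n + m = p)%N) (i : 'I_n.+1) (x : O n) (y : O m) :
  x \in @morph_ker n -> op_comp e i x y \in @morph_ker p.
Proof.
have [_ _ phic] := phiM; move=> /eqP x0; apply/eqP; rewrite phic x0.
exact: linear_fun0 (op_linl e i _).
Qed.

Lemma morph_ker_compr n m p (e : (n + m = p)%N) (i : 'I_n.+1) (x : O n) (y : O m) :
  y \in @morph_ker m -> op_comp e i x y \in @morph_ker p.
Proof.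
have [_ _ phic] := phiM; move=> /eqP y0; apply/eqP; rewrite phic y0.
exact: linear_fun0 (op_linr e i _).
Qed.

Definition ker_ideal : operad_ideal O :=
  @OperadIdeal K O (fun n => @morph_ker n : submodClosed (O n))
    morph_ker_compl morph_ker_compr.

(** The generated ideal is the intersection of all ideals containing [R], and the kernel of [phi] is
    one of them. *)
Lemma ideal_gen_ker k (R : O k -> Prop) :
  (forall r, R r -> phi k r = 0) ->
  forall n x, x \in ideal_gen R n -> phi n x = 0.
Proof.
by move=> R0 n x /asboolP/(_ ker_ideal) Ix; apply/eqP/Ix => r /R0/eqP.
Qed.

Variable I : operad_ideal O.
Hypothesis I0 : forall n x, x \in I n -> phi n x = 0.

Definition quot_ext n (x : quot_operad I n) : P n := phi n (quot_repr x).

Lemma quot_extE n x : quot_ext (quot_pi (I n) x) = phi n x.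
Proof.
have [phil _ _] := phiM; apply/eqP; rewrite -subr_eq0 -(linear_funB (phil n)).
by apply/eqP/I0/quot_piP; rewrite quot_reprK.
Qed.

Lemma quot_ext_morphism : is_operad_morphism quot_ext.
Proof.
have [phil phi1 phic] := phiM; split=> [n a x y||n m p e i x y].
- rewrite -(quot_reprK x) -(quot_reprK y) -quot_pi_linear !quot_extE.
  exact: phil.
- by rewrite quot_extE.
by rewrite -(quot_reprK x) -(quot_reprK y) /= qop_compE !quot_extE.
Qed.

End QuotientMorphisms.

Section Presentations.
Variables (K : fieldType) (G : finType) (R : Free K G 2%N -> Prop).

Lemma mem_ideal_gen r : R r -> r \in ideal_gen R 2%N.
Proof. by move=> Rr; apply/asboolP => J; apply. Qed.

Lemma pres_morphism_eq (P : operad K) (phi psi : forall n, Pres R n -> P n) :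
  is_operad_morphism phi -> is_operad_morphism psi ->
  (forall g, phi 1%N (pgen R g) = psi 1%N (pgen R g)) ->
  forall n x, phi n x = psi n x.
Proof.
move=> phiM psiM E n x; rewrite -(quot_reprK x).
have piM := quot_pi_morphism (ideal_gen R).
exact: (free_morphism_eq (comp_morphism piM phiM) (comp_morphism piM psiM)).
Qed.

(** Chosen preimages of the generators extend to a morphism from the free operad to [O]; followed by
    [phi] it is the quotient map, which is onto. *)
Lemma pres_morphism_surj (O : operad K) (phi : forall n, O n -> Pres R n) :
  is_operad_morphism phi ->
  (forall g, exists x, phi 1%N x = pgen R g) ->
  forall n y, exists x, phi n x = y.
Proof.
move=> phiM /choice[c cE] n y.
have piM := quot_pi_morphism (ideal_gen R).
exists (free_ext c (quot_repr y)); rewrite -[RHS]quot_reprK.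
apply: (free_morphism_eq (comp_morphism (free_ext_morphism c) phiM) piM) => g.
by rewrite free_ext_gen cE.
Qed.

Lemma pres_ext_exists (P : operad K) (c : G -> P 1%N) :
  (forall r, R r -> free_ext c r = 0) ->
  exists2 phi : forall n, Pres R n -> P n, is_operad_morphism phi &
    forall n x, phi n (quot_pi (ideal_gen R n) x) = free_ext c x.
Proof.
move=> R0; have fM := free_ext_morphism c; have I0 := ideal_gen_ker fM R0.
exists (@quot_ext K _ P (fun n => @free_ext K G P c n) (ideal_gen R)).
  exact: quot_ext_morphism.
by move=> n x; apply: quot_extE.
Qed.

End Presentations.

Lemma free_ext_pgen (K : fieldType) (G : finType) (R : Free K G 2%N -> Prop) n x :
  free_ext (P := Pres R) (pgen R) x = quot_pi (ideal_gen R n) x.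
Proof.
apply: (free_morphism_eq (free_ext_morphism _) (quot_pi_morphism _)) => g.
exact: free_ext_gen.
Qed.

Lemma pres_iso (K : fieldType) (G : finType) (R S : Free K G 2%N -> Prop) :
  (forall r, R r -> r \in ideal_gen S 2%N) ->
  (forall r, S r -> r \in ideal_gen R 2%N) ->
  operad_iso (Pres R) (Pres S).
Proof.
move=> RS SR.
have ext (R1 R2 : Free K G 2%N -> Prop) : (forall r, R1 r -> r \in ideal_gen R2 2%N) ->
    exists2 phi : forall n, Pres R1 n -> Pres R2 n, is_operad_morphism phi &
      forall n x, phi n (quot_pi (ideal_gen R1 n) x) = quot_pi (ideal_gen R2 n) x.
  move=> R12; have [|phi phiM phiE] := @pres_ext_exists K G R1 (Pres R2) (pgen R2).
    by move=> r /R12; rewrite free_ext_pgen; apply: (quot_pi0 _ _).2.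
  by exists phi => // n x; rewrite phiE free_ext_pgen.
have [phi phiM phiE] := ext _ _ RS; have [psi _ psiE] := ext _ _ SR.
exists phi => // n; exists (psi n) => x.
  by rewrite -(quot_reprK x) phiE psiE.
by rewrite -(quot_reprK x) psiE phiE.
Qed.

(** * Quadratic duality *)

Lemma lin_compE (K : fieldType) (A : set_operad) n m p (e : (n + m = p)%N) i
    (f : {ffun A n -> K^o}) (g : {ffun A m -> K^o}) t :
  @lin_comp K A n m p e i f g t
  = \sum_u \sum_v f u * g v * (t == so_comp e i u v)%:R.
Proof.
rewrite /lin_comp sum_ffunE; apply: eq_bigr => u _.
by rewrite sum_ffunE; apply: eq_bigr => v _; rewrite !ffunE.
Qed.

(** Among the subspaces contained in [S], one of maximal dimension must contain each [x] of [S], as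
    adding the line of [x] stays inside [S]. This makes projections onto an ideal component
    available. *)
Lemma submod_vspace (K : fieldType) (V : vectType K) (S : submodClosed V) :
  exists U : {vspace V}, forall x, (x \in U) = (x \in S).
Proof.
pose sub (U : {vspace V}) := forall x, x \in U -> x \in S.
pose dimP n := `[< exists2 U, sub U & \dim U = n >].
have ex_dim : exists n, dimP n.
  exists 0%N; apply/asboolP; exists 0%VS; last exact: dimv0.
  by move=> x; rewrite memv0 => /eqP ->; rewrite rpred0.
have dim_le n : dimP n -> (n <= \dim {:V})%N.
  by move=> /asboolP[U _ <-]; rewrite dimvS ?subvf.
have [_ /asboolP[U US <-] Umax] := ex_maxnP ex_dim dim_le.
exists U => x; apply/idP/idP => [/US //|Sx].
have UxS : sub (U + <[x]>)%VS.
  move=> y /memv_addP[u Uu [v /vlineP[a ->] ->]].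
  by rewrite rpredD ?rpredZ ?(US u).
have dimUx : (\dim (U + <[x]>) <= \dim U)%N.
  by apply: Umax; apply/asboolP; exists (U + <[x]>)%VS.
have /eqP -> : U == (U + <[x]>)%VS.
  by rewrite eqEdim addvSl dimUx.
exact: subvP (addvSr _ _) _ (memv_line x).
Qed.

Section Orthogonal.
Variables (K : fieldType) (G : finType).

Lemma ntree2P (t : ntree G 2) :
  exists s : bool * (G * G), (if s.1 then @tree1 G else @tree2 G) s.2.1 s.2.2 = t.
Proof.
case: t => [[//|x [|y [|? ? ?] [|? ? ?]] [|z [|? ? ?] [|? ? ?]]] e] //.
- by exists (false, (x, z)); apply: val_inj.
- by exists (true, (x, y)); apply: val_inj.
Qed.

Lemma big_ntree2 (V : nmodType) (F : ntree G 2 -> V) :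
  \sum_t F t = \sum_x \sum_y (F (tree1 x y) + F (tree2 x y)).
Proof.
pose h (s : bool * (G * G)) := (if s.1 then @tree1 G else @tree2 G) s.2.1 s.2.2.
have [h' h'K] := choice ntree2P.
have hI : injective h.
  by move=> [[] [x y]] [[] [x' y']] /(congr1 val) //= [-> ->].
have hK : cancel h h' by move=> s; apply: hI; apply: h'K.
rewrite (reindex h) /=; last by exists h' => s _; [apply: hK | apply: h'K].
rewrite pair_big /= -(pair_big xpredT xpredT (fun b p => F (h (b, p)))) /=.
by rewrite big_bool /= big_split.
Qed.

(** With two nodes, a leaf as left child of the root characterizes the shape of [tree2]. *)
Definition quad_sign (t : ntree G 2) : K := if val t is Node _ Leaf _ then -1 else 1.

Lemma quad_formE (f g : Free K G 2%N) :
  quad_form f g = \sum_t quad_sign t *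
    ((f : {ffun _ -> K^o}) t * (g : {ffun _ -> K^o}) t).
Proof.
rewrite big_ntree2; apply: eq_bigr => x _; apply: eq_bigr => y _.
by rewrite /quad_sign /= mul1r mulN1r.
Qed.

Lemma quad_formC (f g : Free K G 2%N) : quad_form f g = quad_form g f.
Proof. by rewrite !quad_formE; apply: eq_bigr => t _; rewrite [_ t * _ t]mulrC. Qed.

Lemma quad_formBr (f g h : Free K G 2%N) :
  quad_form f (g - h) = quad_form f g - quad_form f h.
Proof.
rewrite !quad_formE -sumrB; apply: eq_bigr => t _.
by rewrite -mulrBr -mulrBr !ffunE.
Qed.

Lemma quad_form_delta (f : Free K G 2%N) t :
  quad_form f (delta K t) = quad_sign t * (f : {ffun _ -> K^o}) t.
Proof.
rewrite quad_formE (bigD1 t) //= big1 => [|u /negPf ut].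
  by rewrite ffunE eqxx mulr1 addr0.
by rewrite ffunE ut !mulr0.
Qed.

(** Nondegeneracy: the tree basis is orthogonal and each sign is its own inverse. *)
Lemma quad_form_repr (phi : Free K G 2%N -> K^o) : linear phi ->
  exists g, forall f, quad_form f g = phi f.
Proof.
move=> phil; exists [ffun t => quad_sign t * phi (delta K t) : K^o] => f.
rewrite [f in RHS](delta_sum f) (linear_sum_comb _ _ phil) quad_formE.
apply: eq_bigr => t _; rewrite ffunE /quad_sign.
by case: (val t) => [|? [|? ? ?] ?]; rewrite ?mul1r // !mulN1r mulrN opprK.
Qed.

(** Membership in the ideal, rather than in the span of [R], is what comparing the two quotients
    requires. *)
Lemma orth_orth (R : Free K G 2%N -> Prop) f :
  orth (orth R) f -> f \in ideal_gen R 2%N.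
Proof.
pose V : vectType K := {ffun ntree G 2 -> K^o}.
have [U UE] := @submod_vspace K V (ideal_gen R 2%N).
move=> Rf; rewrite -UE.
suff /eqP -> : f == projv U (f : V) by apply: memv_proj.
rewrite -subr_eq0; apply/eqP/ffunP => t; rewrite [RHS]ffunE.
(* A coordinate of the component off [U] vanishes on [U], hence on [R]. The element representing it
   is thus in the annihilator of [R], and [f] pairs to zero with it. *)
pose phi (g : Free K G 2%N) : K^o := ((g : V) - projv U (g : V)) t.
have phil : linear phi.
  by move=> a x y; rewrite /phi linearP opprD addrACA -scalerBr !ffunE.
have [g gE] := quad_form_repr phil.
rewrite -[LHS]/(phi f) -gE; apply: Rf => r Rr.
rewrite quad_formC gE /phi projv_id ?subrr ?ffunE // UE.
exact: mem_ideal_gen.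
Qed.

Lemma pres_orth_orth (R : Free K G 2%N -> Prop) :
  operad_iso (Pres R) (Pres (orth (orth R))).
Proof.
apply: pres_iso => r Rr; last exact: orth_orth.
by apply: mem_ideal_gen => g; rewrite quad_formC; apply.
Qed.

Lemma comp1_gen (x y : G) : comp1 (gen K x) (gen K y) = delta K (tree1 x y).
Proof. exact: lin_comp_delta. Qed.

Lemma comp2_gen (x y : G) : comp2 (gen K x) (gen K y) = delta K (tree2 x y).
Proof. exact: lin_comp_delta. Qed.

Lemma big_ntree1 (V : nmodType) (F : ntree G 1 -> V) :
  \sum_t F t = \sum_x F (corolla x).
Proof.
pose h (t : ntree G 1) : option G := if val t is Node x _ _ then Some x else None.
rewrite (reindex_omap (@corolla G) h) => [|[[//|x [|? ? ?] [|? ? ?]] e] _ //].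
  by apply: eq_bigl => x; rewrite /h /= eqxx.
by congr Some; apply: val_inj.
Qed.

Lemma comp1E (f g : Free K G 1%N) x y :
  ((comp1 f g : {ffun _ -> K^o}) (tree1 x y)
   = (f : {ffun _ -> K^o}) (corolla x) * (g : {ffun _ -> K^o}) (corolla y)) *
  ((comp1 f g : {ffun _ -> K^o}) (tree2 x y) = 0).
Proof.
have E t : (comp1 f g : {ffun _ -> K^o}) t = \sum_x' \sum_y'
    (f : {ffun _ -> K^o}) (corolla x') * (g : {ffun _ -> K^o}) (corolla y')
      * (t == tree1 x' y')%:R.
  by rewrite [LHS]lin_compE big_ntree1; apply: eq_bigr => x' _; rewrite big_ntree1.
rewrite !E; split.
  rewrite (bigD1 x) //= (bigD1 y) //= !big1 ?addr0 ?eqxx ?mulr1 //.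
  - move=> x' /negPf xx'; apply: big1 => y' _.
    case: eqP => [/(congr1 val) [xE _]|_]; last by rewrite mulr0.
    by rewrite xE eqxx in xx'.
  - move=> y' /negPf yy'; case: eqP => [/(congr1 val) [yE]|_]; last by rewrite mulr0.
    by rewrite yE eqxx in yy'.
apply: big1 => x' _; apply: big1 => y' _.
by case: eqP => [/(congr1 val) //|_]; rewrite mulr0.
Qed.

Lemma comp2E (f g : Free K G 1%N) x y :
  ((comp2 f g : {ffun _ -> K^o}) (tree2 x y)
   = (f : {ffun _ -> K^o}) (corolla x) * (g : {ffun _ -> K^o}) (corolla y)) *
  ((comp2 f g : {ffun _ -> K^o}) (tree1 x y) = 0).
Proof.
have E t : (comp2 f g : {ffun _ -> K^o}) t = \sum_x' \sum_y'
    (f : {ffun _ -> K^o}) (corolla x') * (g : {ffun _ -> K^o}) (corolla y')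
      * (t == tree2 x' y')%:R.
  by rewrite [LHS]lin_compE big_ntree1; apply: eq_bigr => x' _; rewrite big_ntree1.
rewrite !E; split.
  rewrite (bigD1 x) //= (bigD1 y) //= !big1 ?addr0 ?eqxx ?mulr1 //.
  - move=> x' /negPf xx'; apply: big1 => y' _.
    case: eqP => [/(congr1 val) [xE _]|_]; last by rewrite mulr0.
    by rewrite xE eqxx in xx'.
  - move=> y' /negPf yy'; case: eqP => [/(congr1 val) [yE]|_]; last by rewrite mulr0.
    by rewrite yE eqxx in yy'.
apply: big1 => x' _; apply: big1 => y' _.
by case: eqP => [/(congr1 val) //|_]; rewrite mulr0.
Qed.

End Orthogonal.

(** Replacing generators by combinations of generators preserves the shape of a tree, so on each
    shape the extension acts by the tensor square of the matrix of [c]. *)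
Lemma free_ext_tree (K : fieldType) (G H : finType) (c : G -> Free K H 1%N)
    (f : Free K G 2%N) x y :
  ((free_ext c f : {ffun _ -> K^o}) (tree1 x y)
   = \sum_a \sum_b (f : {ffun _ -> K^o}) (tree1 a b) *
       ((c a : {ffun _ -> K^o}) (corolla x) * (c b : {ffun _ -> K^o}) (corolla y))) *
  ((free_ext c f : {ffun _ -> K^o}) (tree2 x y)
   = \sum_a \sum_b (f : {ffun _ -> K^o}) (tree2 a b) *
       ((c a : {ffun _ -> K^o}) (corolla x) * (c b : {ffun _ -> K^o}) (corolla y))).
Proof.
have ev1 a b : ntree_ev c (tree1 a b) = comp1 (c a) (c b).
  by rewrite [LHS]ntree_ev_comp !ntree_ev_corolla.
have ev2 a b : ntree_ev c (tree2 a b) = comp2 (c a) (c b).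
  by rewrite [LHS]ntree_ev_comp !ntree_ev_corolla.
have linE (h h' : {ffun ntree H 2 -> K^o}) (k k' : K) t :
    (k *: h + k' *: h') t = k * h t + k' * h' t by rewrite !ffunE.
rewrite /free_ext big_ntree2; split; rewrite sum_ffunE; apply: eq_bigr => a _.
  rewrite sum_ffunE; apply: eq_bigr => b _; rewrite [LHS]linE ev1 ev2.
  by rewrite [X in _ + _ * X](comp2E _ _ _ _).2 mulr0 addr0;
    congr (_ * _); apply: (comp1E _ _ _ _).1.
rewrite sum_ffunE; apply: eq_bigr => b _; rewrite [LHS]linE ev1 ev2.
by rewrite [X in _ * X + _](comp1E _ _ _ _).2 mulr0 add0r;
  congr (_ * _); apply: (comp2E _ _ _ _).1.
Qed.

(** * The morphism zeta *)

(** Triangularity, by strong induction on the index. It recovers the values on the lozenges from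
    those on the diamonds. *)
Lemma prefix_sum_inj (V : zmodType) k (F F' : 'I_k -> V) :
  (forall b : 'I_k, \sum_(a : 'I_k | (a <= b)%N) F a
    = \sum_(a : 'I_k | (a <= b)%N) F' a) ->
  F =1 F'.
Proof.
move=> E a; have [m] := ubnP (a : nat); elim: m a => // m IHm a am.
have := E a; rewrite (bigD1 a) //= [RHS](bigD1 a) //=.
rewrite (eq_bigr F'); first exact: addIr.
move=> b /andP[ba bNa]; apply: IHm; rewrite -ltnS; apply: leq_trans am.
by rewrite ltnS ltn_neqAle bNa.
Qed.

Lemma upK k (a b : 'I_k) : up a (up a b) = up a b.
Proof. by rewrite upA /up maxxx. Qed.

Section Zeta.
Variables (K : fieldType) (gamma : nat).

Let label (g : dias_gens gamma) : 'I_gamma := match g with inl a | inr a => a end.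

(** The image under zeta of the dual generator of index [a], lifted to the free operad. *)
Let twin (a : 'I_gamma) : Free K (dias_gens gamma) 1%N :=
  gen K (inl a) + gen K (inr a).

(** The matrix of [twin] is the incidence matrix of [label], so the double sum of [free_ext_tree]
    has a single nonzero term. *)
Lemma free_ext_twin (f : Free K 'I_gamma 2%N) x y :
  ((free_ext twin f : {ffun _ -> K^o}) (tree1 x y)
   = (f : {ffun _ -> K^o}) (tree1 (label x) (label y))) *
  ((free_ext twin f : {ffun _ -> K^o}) (tree2 x y)
   = (f : {ffun _ -> K^o}) (tree2 (label x) (label y))).
Proof.
have twinE a z : (twin a : {ffun _ -> K^o}) (corolla z) = (a == label z)%:R.
  have corE (u v : dias_gens gamma) : (corolla u == corolla v) = (u == v).
    by apply/eqP/eqP => [/(congr1 val) [] | ->].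
  have deltaE (t u v : ntree (dias_gens gamma) 1) :
      (delta K t + delta K u) v = (v == t)%:R + (v == u)%:R by rewrite !ffunE.
  rewrite [LHS]deltaE !corE /label.
  case: z => z.
    by rewrite [X in _ + X](_ : _ = 0) // addr0 eq_sym.
  by rewrite [X in X + _](_ : _ = 0) // add0r eq_sym.
have sumE (F : 'I_gamma -> 'I_gamma -> K) :
    \sum_a \sum_b F a b * ((a == label x)%:R * (b == label y)%:R) = F (label x) (label y).
  rewrite (bigD1 (label x)) //= (bigD1 (label y)) //= !eqxx !mulr1.
  rewrite !big1 ?addr0 // => [a /negPf ax|b /negPf bn].
    by apply: big1 => b _; rewrite ax mul0r mulr0.
  by rewrite bn !mulr0.
rewrite !free_ext_tree; split.
  rewrite -[RHS](sumE (fun a b => (f : {ffun _ -> K^o}) (tree1 a b))).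
  by apply: eq_bigr => a _; apply: eq_bigr => b _; congr (_ * (_ * _)); apply: twinE.
rewrite -[RHS](sumE (fun a b => (f : {ffun _ -> K^o}) (tree2 a b))).
by apply: eq_bigr => a _; apply: eq_bigr => b _; congr (_ * (_ * _)); apply: twinE.
Qed.

(* [free_ext twin] is adjoint, for the quadratic forms, to the relabeling of   *)
(* trees by [label], which maps the relations of Dias to those of As.          *)
Lemma twin_orth (f : Free K 'I_gamma 2%N) :
  orth (as_rel K gamma) f -> orth (dias_rel K gamma) (free_ext twin f).
Proof.
move=> Rf.
have f1 a b : (f : {ffun _ -> K^o}) (tree1 a b)
    = - (f : {ffun _ -> K^o}) (tree2 (up a b) (up a b)).
  have := Rf _ (AsRel1 K a b); rewrite comp1_gen comp2_gen quad_formBr !quad_form_delta.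
  by rewrite /quad_sign /= mul1r mulN1r opprK => /eqP; rewrite addr_eq0 => /eqP.
have f2 a b : (f : {ffun _ -> K^o}) (tree2 a b)
    = (f : {ffun _ -> K^o}) (tree2 (up a b) (up a b)).
  have := Rf _ (AsRel2 K a b); rewrite !comp2_gen quad_formBr !quad_form_delta.
  by rewrite /quad_sign /= !mulN1r opprK => /eqP; rewrite addrC subr_eq0 => /eqP.
(* By [f1] and [f2] both terms of the pairing depend only on the largest label, with opposite signs;
   all five families of relations satisfy the premise. *)
have pair0 x y z w : up (label x) (label y) = up (label z) (label w) ->
    quad_form (free_ext twin f)
      (comp1 (gen K x) (gen K y) - comp2 (gen K z) (gen K w)) = 0.
  move=> E; rewrite comp1_gen comp2_gen quad_formBr !quad_form_delta !free_ext_twin.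
  by rewrite f1 (f2 (label z)) E /quad_sign /= mul1r mulN1r opprK addNr.
by move=> _ [] a a'; apply: pair0; rewrite /= ?[up (up _ _) _]upC ?upK // upC.
Qed.

Lemma zeta_exists : exists zeta : forall n, DAs K gamma n -> Dendr K gamma n,
  [/\ is_operad_morphism zeta,
      forall a : 'I_gamma,
        zeta 1%N (das_diamond K a) = dendr_prec K a + dendr_succ K a
    & forall zeta' : (forall n, DAs K gamma n -> Dendr K gamma n),
        is_operad_morphism zeta' ->
        (forall a : 'I_gamma,
           zeta' 1%N (das_diamond K a) = dendr_prec K a + dendr_succ K a) ->
        forall n x, zeta' n x = zeta n x].
Proof.
pose c (a : 'I_gamma) : Dendr K gamma 1%N :=
  pgen (orth (dias_rel K gamma)) (inl a) + pgen (orth (dias_rel K gamma)) (inr a).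
have cE n x : free_ext c x
    = quot_pi (ideal_gen (orth (dias_rel K gamma)) n) (free_ext twin x).
  have piM := quot_pi_morphism (ideal_gen (orth (dias_rel K gamma))).
  apply: (free_morphism_eq (free_ext_morphism c)
    (comp_morphism (free_ext_morphism twin) piM)) => a.
  by rewrite !free_ext_gen quot_piD.
have [|zeta zetaM zetaE] :=
  @pres_ext_exists K _ (orth (as_rel K gamma)) (Dendr K gamma) c.
  move=> r Rr; rewrite cE; apply/quot_pi0/mem_ideal_gen; exact: twin_orth.
have zeta_gen a : zeta 1%N (pgen _ a) = c a by rewrite zetaE free_ext_gen.
have zeta_dia a : zeta 1%N (das_diamond K a) = dendr_prec K a + dendr_succ K a.
  have [zetal _ _] := zetaM.
  rewrite (linear_fun_sum (zetal _)) -big_split; apply: eq_bigr => b _.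
  exact: zeta_gen.
exists zeta; split=> // zeta' zeta'M zeta'E; apply: pres_morphism_eq => //.
(* The morphisms must agree on the lozenges, whereas the hypothesis gives their values on the
   diamonds, which are prefix sums of lozenges. *)
apply: prefix_sum_inj => b.
have [zetal _ _] := zetaM; have [zetal' _ _] := zeta'M.
rewrite -(linear_fun_sum (zetal _)) -(linear_fun_sum (zetal' _)).
by rewrite [LHS]zeta'E -zeta_dia.
Qed.

End Zeta.

(** * The presentation of Dias *)

Section TreeCongruence.
Variables (K : fieldType) (G : finType) (R : Free K G 2%N -> Prop).

(** Raw trees spare the arity proofs. Without the equality of node counts, trees of different sizes
    would be vacuously congruent and transitivity would fail. *)
Definition tree_cong (t t' : tree G) : Prop :=
  nodes t = nodes t' /\
  forall n (u u' : ntree G n), val u = t -> val u' = t' ->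
    delta K u - delta K u' \in ideal_gen R n.

Lemma tree_cong_refl t : tree_cong t t.
Proof.
split=> // n u u' <- /val_inj ->.
by rewrite subrr rpred0.
Qed.

Lemma tree_cong_sym t t' : tree_cong t t' -> tree_cong t' t.
Proof.
move=> [tt' tI]; split=> // n u u' ut ut'.
by rewrite -opprB -scaleN1r rpredZ ?tI.
Qed.

Lemma tree_cong_trans t t' t'' :
  tree_cong t t' -> tree_cong t' t'' -> tree_cong t t''.
Proof.
move=> [tt' tI] [tt'' t'I]; split=> [|n u u'' ut ut'']; first by rewrite tt'.
have e : nodes t' == n by rewrite -tt' -ut; exact: (valP u).
rewrite -(subrK (delta K (exist _ t' e : ntree G n)) (delta K u)) -addrA rpredD //.
  exact: tI.
exact: t'I.
Qed.

Lemma tree_cong_graftl t t' : tree_cong t t' ->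
  forall i s, (i <= nodes t)%N -> tree_cong (graft t i s) (graft t' i s).
Proof.
move=> [tt' tI] i s it; split=> [|n u u' ut ut']; first by rewrite !nodes_graft tt'.
pose T : ntree G (nodes t) := exist _ t (eqxx _).
have e' : nodes t' == nodes t by rewrite tt'.
pose T' : ntree G (nodes t) := exist _ t' e'.
pose S : ntree G (nodes s) := exist _ s (eqxx _).
have e : (nodes t + nodes s = n)%N.
  by rewrite -(nodes_graft t i s) -ut; exact: (eqP (valP u)).
have io : (i < (nodes t).+1)%N by [].
have -> : u = ntree_comp e (Ordinal io) T S by apply: val_inj; rewrite ut.
have -> : u' = ntree_comp e (Ordinal io) T' S by apply: val_inj; rewrite ut'.
have := @id_compl _ _ (ideal_gen R) _ _ _ e (Ordinal io) _ (delta K S)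
  (tI _ T T' erefl erefl).
by rewrite op_compBl /= !lin_comp_delta.
Qed.

Lemma tree_cong_graftr t i s s' : (i <= nodes t)%N ->
  tree_cong s s' -> tree_cong (graft t i s) (graft t i s').
Proof.
move=> it [ss' sI]; split=> [|n u u' ut ut']; first by rewrite !nodes_graft ss'.
pose T : ntree G (nodes t) := exist _ t (eqxx _).
have e' : nodes s' == nodes s by rewrite ss'.
pose S' : ntree G (nodes s) := exist _ s' e'.
pose S : ntree G (nodes s) := exist _ s (eqxx _).
have e : (nodes t + nodes s = n)%N.
  by rewrite -(nodes_graft t i s) -ut; exact: (eqP (valP u)).
have io : (i < (nodes t).+1)%N by [].
have -> : u = ntree_comp e (Ordinal io) T S by apply: val_inj; rewrite ut.
have -> : u' = ntree_comp e (Ordinal io) T S' by apply: val_inj; rewrite ut'.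
have := @id_compr _ _ (ideal_gen R) _ _ _ e (Ordinal io) (delta K T) _
  (sI _ S S' erefl erefl).
by rewrite op_compBr /= !lin_comp_delta.
Qed.

Lemma tree_cong_nodel g l l' r :
  tree_cong l l' -> tree_cong (Node g l r) (Node g l' r).
Proof. exact: (@tree_cong_graftr (Node g Leaf r) 0 l l'). Qed.

Lemma tree_cong_noder g l r r' :
  tree_cong r r' -> tree_cong (Node g l r) (Node g l r').
Proof.
move=> /(@tree_cong_graftr (Node g l Leaf) (nodes l).+1 r r') /=.
by rewrite !ltnn addn0 leqnn; apply.
Qed.

Lemma tree_cong_rel x y z w :
  R (comp1 (gen K x) (gen K y) - comp2 (gen K z) (gen K w)) ->
  forall t1 t2 t3,
    tree_cong (Node x (Node y t1 t2) t3) (Node z t1 (Node w t2 t3)).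
Proof.
rewrite comp1_gen comp2_gen => /mem_ideal_gen RI t1 t2 t3.
have : tree_cong (Node x (Node y Leaf Leaf) Leaf) (Node z Leaf (Node w Leaf Leaf)).
  split=> // n u u' ut ut'; have n2 : n = 2 by rewrite -(eqP (valP u)) ut.
  subst n; have -> : u = tree1 x y by apply: val_inj.
  by have -> : u' = tree2 z w by apply: val_inj.
(* Grafting from right to left keeps the indices of the remaining leaves. *)
move=> /tree_cong_graftl/(_ 2 t3 isT)/tree_cong_graftl/(_ 1 t2 isT).
by move=> /tree_cong_graftl/(_ 0 t1 isT).
Qed.

End TreeCongruence.

Section DiasNormalForms.
Variables (K : fieldType) (gamma : nat).

Local Notation dtree := (tree (dias_gens gamma)).
Local Notation "t ~~> t'" := (tree_cong (dias_rel K gamma) t t') (at level 70).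
Local Notation lift0 := (@lift gamma.+1 ord0).

Lemma dias_cong1 a b (x y z : dtree) :
  Node (inl a) (Node (inr b) x y) z ~~> Node (inr b) x (Node (inl a) y z).
Proof. by apply: tree_cong_rel; apply: DiasRel1. Qed.

Lemma dias_cong2 a b (x y z : dtree) :
  Node (inl a) (Node (inl (up a b)) x y) z ~~> Node (inl a) x (Node (inr b) y z).
Proof. by apply: tree_cong_rel; apply: DiasRel2. Qed.

Lemma dias_cong3 a b (x y z : dtree) :
  Node (inr a) (Node (inl b) x y) z ~~> Node (inr a) x (Node (inr (up a b)) y z).
Proof. by apply: tree_cong_rel; apply: DiasRel3. Qed.

Lemma dias_cong4 a b (x y z : dtree) :
  Node (inl (up a b)) (Node (inl a) x y) z ~~> Node (inl a) x (Node (inl b) y z).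
Proof. by apply: tree_cong_rel; apply: DiasRel4. Qed.

Lemma dias_cong5 a b (x y z : dtree) :
  Node (inr a) (Node (inr b) x y) z ~~> Node (inr (up a b)) x (Node (inr a) y z).
Proof. by apply: tree_cong_rel; apply: DiasRel5. Qed.

Definition lprod (u : seq 'I_gamma) (t : dtree) : dtree :=
  foldr (fun a s => Node (inr a) Leaf s) t u.

Definition rprod (t : dtree) (v : seq 'I_gamma) : dtree :=
  foldl (fun s b => Node (inl b) s Leaf) t v.

(** The chosen representative of the word u 0 v, as [tree_word_nf] confirms. *)
Definition dias_nf (u v : seq 'I_gamma) : dtree := lprod u (rprod Leaf v).

(** The word u 0 v after taking the maximum of each letter with [a]: its zero becomes [a], so no
    zero is left. *)
Definition up_word a (u v : seq 'I_gamma) : seq 'I_gamma :=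
  map (up a) u ++ a :: map (up a) v.

Lemma lprod_cat u u' t : lprod (u ++ u') t = lprod u (lprod u' t).
Proof. exact: foldr_cat. Qed.

Lemma rprod_rcons t v b : rprod t (rcons v b) = Node (inl b) (rprod t v) Leaf.
Proof. exact: foldl_rcons. Qed.

Lemma lprod_cong u t t' : t ~~> t' -> lprod u t ~~> lprod u t'.
Proof. by move=> tt'; elim: u => //= a u IH; apply: tree_cong_noder. Qed.

(** The fifth relation extracts the letters of [u] from the left, then the third those of [v] from
    the right; each letter extracted is raised to at least [a]. *)
Lemma node_vdash_nf a u v t :
  Node (inr a) (dias_nf u v) t ~~> lprod (up_word a u v) t.
Proof.
elim: u => [|b u IH] /=.
  elim/last_ind: v t => [|v b IH] t; first exact: tree_cong_refl.
  rewrite /dias_nf /= rprod_rcons; apply: tree_cong_trans (dias_cong3 _ _ _ _ _) _.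
  apply: tree_cong_trans (IH _) _.
  by rewrite /up_word map_rcons /= -cats1 lprod_cat; apply: tree_cong_refl.
apply: tree_cong_trans (dias_cong5 _ _ _ _ _) _.
exact: tree_cong_noder IH.
Qed.

(** Mirror argument with the second and fourth relations read backwards. The tree [t] varies in the
    induction on [u] because it absorbs the letters of [u]. *)
Lemma node_dashv_nf a u v t :
  Node (inl a) t (dias_nf u v) ~~> rprod t (up_word a u v).
Proof.
elim: u t => [|b u IH] t; last first.
  apply: tree_cong_trans (tree_cong_sym (dias_cong2 _ _ _ _ _)) _.
  exact: IH.
elim/last_ind: v => [|v b IH]; first exact: tree_cong_refl.
rewrite /dias_nf [lprod _ _]/= rprod_rcons /up_word cat0s map_rcons.
rewrite -rcons_cons rprod_rcons.
apply: tree_cong_trans (tree_cong_sym (dias_cong4 _ _ _ _ _)) _.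
exact: tree_cong_nodel.
Qed.

Lemma node_nf_dashv a u v t :
  Node (inl a) (dias_nf u v) t ~~> lprod u (Node (inl a) (rprod Leaf v) t).
Proof.
elim: u => [|b u IH] /=; first exact: tree_cong_refl.
apply: tree_cong_trans (dias_cong1 _ _ _ _ _) _.
exact: tree_cong_noder.
Qed.

(** Evaluation in Dias computed on bare sequences; [ntree_ev_word] links it to the operadic
    evaluation. *)
Fixpoint tree_word (t : dtree) : seq 'I_gamma.+1 :=
  match t with
  | Leaf => [:: ord0]
  | Node (inl a) l r => tree_word l ++ map (up (lift0 a)) (tree_word r)
  | Node (inr a) l r => map (up (lift0 a)) (tree_word l) ++ tree_word r
  end.

Definition zword (u v : seq 'I_gamma) : seq 'I_gamma.+1 :=
  map lift0 u ++ ord0 :: map lift0 v.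

Lemma zword_catl u u' v : zword (u ++ u') v = map lift0 u ++ zword u' v.
Proof. by rewrite /zword map_cat -catA. Qed.

Lemma zword_catr u v v' : zword u (v ++ v') = zword u v ++ map lift0 v'.
Proof. by rewrite /zword map_cat -catA. Qed.

Lemma zword_inj u v u' v' : zword u v = zword u' v' -> u = u' /\ v = v'.
Proof.
elim: u u' => [|a u IH] [|a' u'] //= /eqP.
  by rewrite eqseq_cons eqxx (inj_eq (inj_map lift_inj)) => /eqP.
by rewrite eqseq_cons (inj_eq lift_inj) => /andP[/eqP -> /eqP/IH[-> ->]].
Qed.

Lemma zwordP (w : seq 'I_gamma.+1) : one_zero w -> exists u v, w = zword u v.
Proof.
rewrite /one_zero.
have nz (s : seq 'I_gamma.+1) : count_mem ord0 s = 0%N -> exists v, s = map lift0 v.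
  elim: s => [|a s IH] /=; first by exists [::].
  case: (unliftP ord0 a) => [b ->|->] //=.
  by rewrite add0n => /IH[v ->]; exists (b :: v).
elim: w => [//|a w IH] /=.
case: (unliftP ord0 a) => [b ->|->] /=.
  by rewrite add0n => /IH[u [v ->]]; exists (b :: u), v.
by move=> /eqP[/nz[v ->]]; exists [::], v.
Qed.

Lemma up_lift0 (a b : 'I_gamma) : up (lift0 a) (lift0 b) = lift0 (up a b).
Proof.
rewrite /up; case: (leP a b) => ab.
  by apply/max_idPr.
by apply/max_idPl; apply: ltW.
Qed.

Lemma map_up_zword a u v :
  map (up (lift0 a)) (zword u v) = map lift0 (up_word a u v).
Proof.
rewrite /zword /up_word !map_cat /= upC up0letter -!map_comp.
congr (_ ++ _ :: _); apply: eq_map => b /=; exact: up_lift0.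
Qed.

Lemma tree_cong_nf t :
  exists u v, t ~~> dias_nf u v /\ tree_word t = zword u v.
Proof.
elim: t => [|[a|a] l [u [v [lE wl]]] r [u' [v' [rE wr]]]] /=.
- by exists [::], [::]; split=> //; apply: tree_cong_refl.
- exists u, (v ++ up_word a u' v'); split; last first.
    by rewrite wl wr map_up_zword zword_catr.
  apply: tree_cong_trans (tree_cong_nodel _ _ lE) _.
  apply: tree_cong_trans (tree_cong_noder _ _ rE) _.
  apply: tree_cong_trans (node_nf_dashv _ _ _ _) _.
  apply: lprod_cong; rewrite /rprod foldl_cat; exact: node_dashv_nf.
exists (up_word a u v ++ u'), v'; split; last first.
  by rewrite wl wr map_up_zword zword_catl.
apply: tree_cong_trans (tree_cong_nodel _ _ lE) _.
apply: tree_cong_trans (tree_cong_noder _ _ rE) _.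
rewrite /dias_nf lprod_cat; exact: node_vdash_nf.
Qed.

(** Completeness of the relations: a word splits uniquely at its zero, so equal words give the same
    normal form. *)
Lemma tree_word_cong t t' : tree_word t = tree_word t' -> t ~~> t'.
Proof.
have [u [v [tE ->]]] := tree_cong_nf t; have [u' [v' [t'E ->]]] := tree_cong_nf t'.
move=> /zword_inj[uu vv]; subst u' v'.
exact: tree_cong_trans tE (tree_cong_sym t'E).
Qed.

Lemma tree_word_nf u v : tree_word (dias_nf u v) = zword u v.
Proof.
elim: u => [|a u IH] /=; last by rewrite IH upC up0letter.
elim/last_ind: v => [//|v b IH]; rewrite /dias_nf /= rprod_rcons /= [tree_word _]IH.
by rewrite upC up0letter /zword /= map_rcons cats1.
Qed.

Lemma size_tree_word t : size (tree_word t) = (nodes t).+1.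
Proof.
by elim: t => // -[a|a] l IHl r IHr; rewrite /= size_cat size_map IHl IHr; lia.
Qed.

Lemma word_tree n (w : word gamma n) :
  exists t : ntree (dias_gens gamma) n, tree_word (val t) = val w :> seq _.
Proof.
have [u [v wE]] := zwordP (valP w).
have e : nodes (dias_nf u v) == n.
  by rewrite -eqSS -size_tree_word tree_word_nf -wE size_tuple.
by exists (exist _ (dias_nf u v) e : ntree _ n); rewrite tree_word_nf.
Qed.

Definition dias_gen (g : dias_gens gamma) : Dias K gamma 1%N :=
  delta K (match g with inl a => word0a a | inr a => worda0 a end).

Lemma ntree_ev_word n (t : ntree (dias_gens gamma) n) :
  exists2 w : word gamma n, val w = tree_word (val t) :> seq _ &
    ntree_ev dias_gen t = delta K w.
Proof.
move: n t; apply: ntree_ind => [|n m q p e1 e2 g l r [wl lE lD] [wr rE rD]].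
  by exists (word_one gamma); rewrite ?ntree_ev_leaf.
rewrite val_node ntree_ev_node lD rD.
pose wg : word gamma 1 := match g with inl a => word0a a | inr a => worda0 a end.
exists (word_comp e2 ord_max (word_comp e1 ord0 wg wl) wr); last first.
  by rewrite /= !lin_comp_delta.
(* Once [wl] replaces the first letter of the generator, its second letter has index [q], where [wr]
   is then substituted. *)
have sl : size (val wl) = q by rewrite size_tuple -e1.
have up0 (s : seq 'I_gamma.+1) : map (up ord0) s = s.
  by rewrite -[RHS]map_id; apply: eq_map => b; apply: up0letter.
case: g @wg => a wg; rewrite /= -lE -rE /word_subst /=.
  rewrite up0 nth_cat sl ltnn subnn /= take_size_cat // drop_oversize ?cats0 //.
  by rewrite size_cat sl addn1.
have sl' : size (map (up (lift0 a)) (val wl)) = q by rewrite size_map.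
rewrite nth_cat sl' ltnn subnn /= up0 take_size_cat // drop_oversize ?cats0 //.
by rewrite size_cat sl' addn1.
Qed.

Lemma ntree_ev_word_eq n (t t' : ntree (dias_gens gamma) n) :
  tree_word (val t) = tree_word (val t') -> ntree_ev dias_gen t = ntree_ev dias_gen t'.
Proof.
have [w wE ->] := ntree_ev_word t; have [w' w'E ->] := ntree_ev_word t'.
by move=> E; congr delta; apply/val_inj/val_inj; rewrite [LHS]wE [RHS]w'E.
Qed.

Lemma dias_gen_rel r : dias_rel K gamma r -> free_ext dias_gen r = 0.
Proof.
have up0r (a : 'I_gamma.+1) : up a ord0 = a by rewrite upC up0letter.
have ev0 x y z w : tree_word (Node x (Node y Leaf Leaf) Leaf)
      = tree_word (Node z Leaf (Node w Leaf Leaf)) ->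
    free_ext dias_gen (comp1 (gen K x) (gen K y) - comp2 (gen K z) (gen K w)) = 0.
  move=> E; rewrite comp1_gen comp2_gen (linear_funB (@free_ext_linear _ _ _ _ 2)).
  by rewrite !free_ext_delta (@ntree_ev_word_eq _ (tree1 x y) (tree2 z w)) // subrr.
by case=> a a'; apply: ev0; rewrite /= ?up0r ?up_lift0 // (upC _ a) ?upK.
Qed.

Theorem dias_presentation :
  exists2 psi : forall n, Pres (dias_rel K gamma) n -> Dias K gamma n,
    is_operad_morphism psi /\ (forall n, bijective (psi n)) &
    forall g, psi 1%N (pgen (dias_rel K gamma) g) = dias_gen g.
Proof.
have [psi psiM psiE] := pres_ext_exists dias_gen_rel.
exists psi; last by move=> g; rewrite psiE free_ext_gen.
have [psil _ _] := psiM; split=> // n.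
have [s sE] := choice (@word_tree n).
pose pi (x : Free K (dias_gens gamma) n) : Pres (dias_rel K gamma) n :=
  quot_pi (ideal_gen (dias_rel K gamma) n) x.
have pil : linear pi by apply: quot_pi_linear.
(* The linear inverse: a word goes to the class of some tree [s w] of that value. It is a left
   inverse of [psi] by [tree_word_cong]. *)
pose theta (f : {ffun word gamma n -> K^o}) : Pres (dias_rel K gamma) n :=
  \sum_w f w *: pi (delta K (s w)).
have psi_delta (t : ntree (dias_gens gamma) n) :
    exists2 w : word gamma n, val w = tree_word (val t) :> seq _ &
    psi n (pi (delta K t)) = delta K w.
  have [w wE wD] := ntree_ev_word t; exists w => //.
  by rewrite /pi psiE free_ext_delta.
have theta_lin : linear theta.
  move=> a f f'; rewrite /theta scaler_sumr -big_split /=.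
  by apply: eq_bigr => w _; rewrite !ffunE scalerDl scalerA.
have theta_delta w : theta (delta K w) = pi (delta K (s w)).
  rewrite /theta (bigD1 w) //= big1 => [|u /negPf uw].
    by rewrite ffunE eqxx scale1r addr0.
  by rewrite ffunE uw scale0r.
exists theta => [x|f]; last first.
  rewrite [f in RHS]delta_sum /theta (linear_sum_comb _ _ (psil n)).
  apply: eq_bigr => w _; congr (_ *: _); have [w' w'E ->] := psi_delta (s w).
  by congr delta; apply/val_inj/val_inj; rewrite [LHS]w'E [LHS]sE.
rewrite -(quot_reprK x) -/(pi _); move: (quot_repr x) => {x} f.
rewrite [f in LHS]delta_sum [f in RHS]delta_sum.
rewrite !(linear_sum_comb _ _ pil) (linear_sum_comb _ _ (psil n)).
rewrite (linear_sum_comb _ _ theta_lin); apply: eq_bigr => t _; congr (_ *: _).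
have [w wE ->] := psi_delta t; rewrite theta_delta; apply/quot_piP.
have [|_] := @tree_word_cong (val (s w)) (val t); first by rewrite [LHS]sE [LHS]wE.
by apply.
Qed.

End DiasNormalForms.

(** * The morphism eta *)

(** Choice turns the bijectivity in each arity into one family of inverses; the morphism laws can be
    checked after applying the injective [phi]. *)
Lemma inverse_morphism (K : fieldType) (O P : operad K) (phi : forall n, O n -> P n) :
  is_operad_morphism phi -> (forall n, bijective (phi n)) ->
  exists theta : forall n, P n -> O n,
    [/\ is_operad_morphism theta, forall n, cancel (phi n) (theta n)
      & forall n, cancel (theta n) (phi n)].
Proof.
move=> [phil phi1 phic] phiB.
have phi_onto n y : exists x, phi n x = y.
  by have [g _ gK] := phiB n; exists (g y).
pose theta n (y : P n) : O n := sval (cid (phi_onto n y)).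
have thetaK n : cancel (@theta n) (phi n) by move=> y; rewrite /theta; case: cid.
have phiK n : cancel (phi n) (@theta n).
  by move=> x; apply: (bij_inj (phiB n)); rewrite thetaK.
exists theta; split=> //; split=> [n a x y||n m p e i x y];
  apply: (bij_inj (phiB _)); rewrite thetaK.
- by rewrite phil !thetaK.
- by rewrite phi1.
by rewrite phic !thetaK.
Qed.

Section Eta.
Variables (K : fieldType) (gamma : nat).

Lemma dias_iso : operad_iso (Dias K gamma) (Pres (dias_rel K gamma)).
Proof.
have [psi [psiM psiB] _] := dias_presentation K gamma.
have [theta [thetaM psiK thetaK]] := inverse_morphism psiM psiB.
by exists theta => // n; exists (psi n).
Qed.

Lemma eta_exists : exists eta : forall n, Dias K gamma n -> As K gamma n,
  [/\ is_operad_morphism eta,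
      forall a : 'I_gamma,
        eta 1%N (delta K (word0a a)) = as_star K a /\
        eta 1%N (delta K (worda0 a)) = as_star K a,
      forall n (y : As K gamma n), exists x, eta n x = y
    & forall eta' : (forall n, Dias K gamma n -> As K gamma n),
        is_operad_morphism eta' ->
        (forall a : 'I_gamma,
           eta' 1%N (delta K (word0a a)) = as_star K a /\
           eta' 1%N (delta K (worda0 a)) = as_star K a) ->
        forall n x, eta' n x = eta n x].
Proof.
have [psi [psiM psiB] psi_gen] := dias_presentation K gamma.
have [theta [thetaM psiK thetaK]] := inverse_morphism psiM psiB.
pose c (g : dias_gens gamma) : As K gamma 1%N :=
  match g with inl a | inr a => as_star K a end.
have c0 r : dias_rel K gamma r -> free_ext c r = 0.
  pose d (g : dias_gens gamma) : Free K 'I_gamma 1%N :=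
    match g with inl a | inr a => gen K a end.
  have cE n x : free_ext c x = quot_pi (ideal_gen (as_rel K gamma) n) (free_ext d x).
    have piM := quot_pi_morphism (ideal_gen (as_rel K gamma)).
    apply: (free_morphism_eq (free_ext_morphism c)
      (comp_morphism (free_ext_morphism d) piM)) => g.
    by rewrite !free_ext_gen; case: g.
  have [dl _ dc] := free_ext_morphism d.
  have dE x y z w : free_ext d (comp1 (gen K x) (gen K y) - comp2 (gen K z) (gen K w))
      = comp1 (d x) (d y) - comp2 (d z) (d w).
    by rewrite (linear_funB (dl _)) /comp1 /comp2 !dc !free_ext_gen.
  (* Both trees are congruent to the same right comb on the largest label; subtracting the two
     relations cancels that comb. *)
  have as_rel_up a b a' b' : up a b = up a' b' ->
      comp1 (gen K a) (gen K b) - comp2 (gen K a') (gen K b')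
        \in ideal_gen (as_rel K gamma) 2%N.
    move=> E; have /mem_ideal_gen I1 := AsRel1 K a b.
    have /mem_ideal_gen I2 := AsRel2 K a' b'.
    by have := rpredB I1 I2; rewrite E opprB addrA subrK.
  move=> Rr; rewrite cE; apply/quot_pi0.
  by case: Rr => a a'; rewrite dE; apply: as_rel_up;
    rewrite ?[up (up _ _) _]upC ?upK // upC.
have [eta0 eta0M eta0E] := pres_ext_exists c0.
have eta0_gen g : eta0 1%N (pgen _ g) = c g by rewrite eta0E free_ext_gen.
have etaM := comp_morphism thetaM eta0M.
have eta_gen g : eta0 1%N (theta 1%N (dias_gen K g)) = c g.
  by rewrite -psi_gen psiK eta0_gen.
exists (fun n x => eta0 n (theta n x)); split=> //.
- by move=> a; split; [apply: (eta_gen (inl a)) | apply: (eta_gen (inr a))].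
- apply: (pres_morphism_surj etaM) => a.
  by exists (dias_gen K (inl a)); rewrite eta_gen.
(* Writing [x] as [psi (theta x)] moves the comparison to the presented operad, where generators
   suffice. *)
move=> eta' eta'M eta'E n x; rewrite -(thetaK _ x) psiK.
apply: (pres_morphism_eq (comp_morphism psiM eta'M) eta0M) => g.
by rewrite psi_gen eta0_gen; case: g => a; have [] := eta'E a.
Qed.

End Eta.

Theorem theorem5p2p3 (K : fieldType) (charK0 : [pchar K] =i pred0)
    (gamma : nat) :
  [/\ koszul_dual (dias_rel K gamma) (Dias K gamma) (Dendr K gamma) /\
      koszul_dual (orth (dias_rel K gamma)) (Dendr K gamma) (Dias K gamma),
      koszul_dual (as_rel K gamma) (As K gamma) (DAs K gamma) /\
      koszul_dual (orth (as_rel K gamma)) (DAs K gamma) (As K gamma),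
      exists eta : forall n, Dias K gamma n -> As K gamma n,
        [/\ is_operad_morphism eta,
            forall a : 'I_gamma,
              eta 1%N (delta K (word0a a)) = as_star K a /\
              eta 1%N (delta K (worda0 a)) = as_star K a,
            forall n (y : As K gamma n), exists x, eta n x = y
          & forall eta' : (forall n, Dias K gamma n -> As K gamma n),
              is_operad_morphism eta' ->
              (forall a : 'I_gamma,
                 eta' 1%N (delta K (word0a a)) = as_star K a /\
                 eta' 1%N (delta K (worda0 a)) = as_star K a) ->
              forall n x, eta' n x = eta n x]
    & exists zeta : forall n, DAs K gamma n -> Dendr K gamma n,
        [/\ is_operad_morphism zeta,
            forall a : 'I_gamma,
              zeta 1%N (das_diamond K a) = dendr_prec K a + dendr_succ K a
          & forall zeta' : (forall n, DAs K gamma n -> Dendr K gamma n),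
              is_operad_morphism zeta' ->
              (forall a : 'I_gamma,
                 zeta' 1%N (das_diamond K a) =
                 dendr_prec K a + dendr_succ K a) ->
              forall n x, zeta' n x = zeta n x]].
Proof.
split; last exact: zeta_exists; last exact: eta_exists.
(* Dendr, As and DAs are defined by their presentations, so reflexivity covers them; Dias needs
   [dias_iso], and the duals of Dendr and DAs need the double annihilator. *)
- split; split; try exact: operad_iso_refl; first exact: dias_iso.
  exact: operad_iso_trans (dias_iso K gamma) (pres_orth_orth _).
split; split; try exact: operad_iso_refl.
exact: pres_orth_orth.
Qed.
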